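(* Suppose $\Gamma$ is a locally weakly independent lattice configuration in $\mathfrak B_d$ and $0<r<d$. Then projective sub-representations are dense in $LG_r(\Gamma)_0=\mathrm{Gr}(\mathbf r,M_\Gamma)$. Moreover, a representation $[M]\in LG_r(\Gamma)_0$ is projective if and only if its rank vector $\Phi(M)$ is maximal (for the coordinatewise order) among the rank vectors of points of $LG_r(\Gamma)_0$. In particular, the irreducible components of $LG_r(\Gamma)_0$ are exactly the closures $\mathcal S_M^c$ of the quiver strata $\mathcal S_M$, where $M$ runs over the isomorphism classes of projective sub-representations of $M_\Gamma$ of dimension $\mathbf r=(r,\dots,r)$.
   Context: $R$ is a discrete valuation ring with fraction field $K$, uniformizer $\pi$ and algebraically closed residue field $\kappa$; $0<r<d$ are integers. A lattice in $K^d$ is a free $R$-submodule $L\subset K^d$ with $L\otimes_RK\to K^d$ an isomorphism; $[L]$ is its homothety class. Distinct classes are adjacent if they have representatives with $\pi L_1\subset L_2\subset L_1$; $\mathfrak B_d$ is the flag complex of homothety classes under adjacency. A convex lattice configuration is a finite nonempty set $\Gamma$ of classes such that $[L_1\cap L_2]\in\Gamma$ for any representatives $L_1,L_2$ of two members of $\Gamma$. Write $\Gamma=\{[L_v]\}_v$ with fixed representatives and identify $\Gamma$ with the index set. For $u,v\in\Gamma$ let $n_{u,v}$ be the minimal integer with $\pi^{n_{u,v}}L_u\subset L_v$, put $\overline L_v=L_v/\pi L_v$, and let $f_{u,v}:\overline L_u\to\overline L_v$ be induced by multiplication by $\pi^{n_{u,v}}$. $f_{u,v}$ factors through $w$ if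 $f_{u,v}=f_{w,v}\circ f_{u,w}$. $Q(\Gamma)'$ is the quiver with vertex set $\Gamma$ and one arrow $(u,v)$ for each ordered pair $u\ne v$. $Q(\Gamma)$ is obtained from it by removing every arrow $(u,v)$ for which some path of length $\ge2$ from $u$ to $v$ in $Q(\Gamma)'$ has composite map equal to $f_{u,v}$. $M_\Gamma=(\overline L_v)_v$ is the representation of $Q(\Gamma)$ with maps $f_{u,v}$. ''Projective'' means projective as a module over the path algebra of $Q(\Gamma)$ modulo the relations satisfied by $M_\Gamma$ (paths with zero composite are zero; parallel paths with the same composite are equal); concretely, a sub-representation of $M_\Gamma$ is projective iff it is a direct sum of sub-representations each generated by one vector $x\in\overline L_v$ with $f_{v,w}(x)\neq0$ for all $w\in\Gamma$. A convex $\Gamma$ is locally weakly independent at $v$ if there is $I_v\subset\Gamma\setminus\{v\}$ such that (1) for each $u\ne v$, $f_{u,v}$ factors through some $w\in I_v$; (2) $\{\operatorname{Im} f_{w,v}=\ker f_{v,w}\}_{w\in I_v}$ are linearly independent subspaces of $\overline L_v$. It is locally weakly independent if it is so at every $v\in\Gamma$. $LG_r(\Gamma)$ is the projective $R$-scheme whose $T$-points are collections of rank-$r$ sub-bundles $E_v\subset L_v\otimes\mathcal O_T$ $(v\in\Gamma)$ such that for every inclusion $\pi^k:L_u\hookrightarrow L_v$ ($k\in\mathbb Z$) the induced map $L_u\otimes\mathcal O_T\to L_v\otimes\mathcal O_T$ sends $E_u$ into $E_v$. The points of its special fiber $LG_r(\Gamma)_0$ are the sub-representations of $M_\Gamma$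 of dimension $\mathbf r$, i.e. it is set-theoretically the quiver Grassmannian $\mathrm{Gr}(\mathbf r,M_\Gamma)$. The quiver stratum $\mathcal S_M$ is the set of points whose representation is isomorphic to $M$. The rank vector of $M=(U_v)_v$ is $\Phi(M)=(\dim f_{u,v}(U_u))_{u,v\in\Gamma}$. *)

(* Defs.v *)
From HB Require Import structures.
From mathcomp Require Import all_boot all_order all_algebra.
From mathcomp Require Import boolp classical_sets functions topology.
From mathcomp Require mpoly.
Import -(notations) mpoly.

Set Implicit Arguments.
Unset Strict Implicit.
Unset Printing Implicit Defensive.

Import Order.TTheory GRing.Theory Num.Theory.

Local Open Scope classical_set_scope.
Local Open Scope ring_scope.

Definition is_ideal (R : idomainType) (I : set R) : Prop :=
  [/\ I 0, forall x y, I x -> I y -> I (x + y) & forall a x, I x -> I (a * x)].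

Definition nonunits (R : idomainType) : set R :=
  [set x | x \isn't a GRing.unit].

(* A local principal ideal domain that is not a field. *)
Definition is_dvr (R : idomainType) : Prop :=
  [/\ forall I : set R, is_ideal I -> exists a, I = range (fun x => a * x),
      is_ideal (@nonunits R) &
      exists2 x : R, x != 0 & nonunits x].

Definition is_uniformizer (R : idomainType) (pi : R) : Prop :=
  @nonunits R = range (fun x => pi * x).

(* [res] exhibits [F] as the quotient of [R] by its maximal ideal. *)
Definition is_residue_map (R : idomainType) (F : fieldType)
    (res : {rmorphism R -> F}) : Prop :=
  range res = setT /\ forall x, res x = 0 <-> nonunits x.

(* The free R-module on the rows of B; for B invertible over the fraction
   field, these are exactly the lattices in K^d. *)
Definition lat (R : idomainType) (d : nat) (B : 'M[{fraction R}]_d) :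
    set 'rV[{fraction R}]_d :=
  range (fun c : 'rV[R]_d => map_mx (@FracField.tofrac R) c *m B).

Definition homothetic (K : fieldType) (d : nat) (L1 L2 : set 'rV[K]_d) : Prop :=
  exists2 c : K, c != 0 & L2 = [set c *: x | x in L1].

(* A quiver with at most one arrow for each ordered pair is a relation E. *)
Inductive qpath (V : Type) (E : rel V) : V -> V -> Type :=
| QNil v : qpath E v v
| QCons u w v : E u w -> qpath E w v -> qpath E u v.

Fixpoint qlength (V : Type) (E : rel V) (u v : V) (p : qpath E u v) : nat :=
  match p with QNil _ => 0%N | QCons _ _ _ _ q => (qlength q).+1 end.

Record qrep (F : fieldType) (V : Type) (E : rel V) := QRep {
  qspace :> V -> lmodType F;
  qmap : forall u v, E u v -> {linear qspace u -> qspace v} }.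
Arguments qmap {F V E} _ {u v} _.

Fixpoint qcomp (F : fieldType) (V : Type) (E : rel V) (N : qrep F E)
    (u v : V) (p : qpath E u v) : N u -> N v :=
  match p in qpath _ u v return N u -> N v with
  | QNil _ => id
  | QCons _ _ _ e q => fun x => @qcomp F V E N _ _ q (qmap N e x)
  end.
Arguments qcomp {F V E} N {u v} p x.

Record qhom (F : fieldType) (V : Type) (E : rel V) (N N' : qrep F E) := QHom {
  qhom_fun :> forall v, {linear N v -> N' v};
  qhomP : forall u v (e : E u v) (x : N u),
    qhom_fun v (qmap N e x) = qmap N' e (qhom_fun u x) }.

Definition qiso (F : fieldType) (V : Type) (E : rel V) (N N' : qrep F E) :=
  exists phi : qhom N N', forall v, bijective (phi v).

Definition satisfies_relations_of (F : fieldType) (V : Type) (E : rel V)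
    (M N : qrep F E) : Prop :=
  (forall u v (p : qpath E u v),
     (forall x, qcomp M p x = 0) -> forall x, qcomp N p x = 0) /\
  (forall u v (p q : qpath E u v),
     qcomp M p =1 qcomp M q -> qcomp N p =1 qcomp N q).

(* Modules over the path algebra modulo the relations of M are the
   representations satisfying these relations, and surjections of modules
   are the vertexwise surjective morphisms. *)
Definition projective_mod (F : fieldType) (V : Type) (E : rel V)
    (M P : qrep F E) : Prop :=
  satisfies_relations_of M P /\
  forall (N N' : qrep F E) (g : qhom N N') (h : qhom P N'),
    satisfies_relations_of M N -> satisfies_relations_of M N' ->
    (forall v (y : N' v), exists x, g v x = y) ->
    exists h' : qhom P N, forall v x, g v (h' v x) = h v x.

Section GrassmannianProduct.
Variables (F : fieldType) (V : finType) (d r : nat).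

Definition grass := {U : {vspace 'rV[F]_d} | \dim U == r}.

Definition grprod := {ffun V -> grass}.

Definition gsub (U : grprod) (v : V) : {vspace 'rV[F]_d} := val (U v).

Definition frame (U : grprod) (A : V -> 'M[F]_(r, d)) : Prop :=
  forall v x, (x \in gsub U v) = (x <= A v)%MS.

(* Pluecker coordinates are indexed by a factor v and an r-tuple g of columns
   (all r-tuples rather than only the increasing ones: the additional
   coordinates are zero or agree with the usual ones up to sign). *)
Definition plucker_index := (V * {ffun 'I_r -> 'I_d})%type.

Definition plucker_poly := mpoly.mpoly #|{: plucker_index}| F.

Definition plucker (A : V -> 'M[F]_(r, d)) (i : 'I_#|{: plucker_index}|) : F :=
  \det (colsub (enum_val i).2 (A (enum_val i).1)).

(* A polynomial in the multihomogeneous coordinates vanishes at a point if it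
   vanishes at all coordinate vectors of that point; changing the frame of
   U v rescales the coordinates of the factor v by an arbitrary nonzero
   scalar. *)
Definition vanishes (P : plucker_poly) (U : grprod) : Prop :=
  forall A, frame U A -> mpoly.meval (plucker A) P = 0.

Definition zlocus (S : set plucker_poly) : set grprod :=
  [set U | forall P, S P -> vanishes P U].

Definition zopen : set_system grprod := [set O | exists S, O = ~` zlocus S].

Lemma frame_exists U : exists A, frame U A.
Proof.
exists (fun v => \matrix_(i < r) (vbasis (gsub U v))`_i) => v x.
have /eqP dU : \dim (gsub U v) == r by exact: (valP (U v)).
set A := \matrix_(i < r) _.
apply/idP/idP => [xU|/submxP[D ->]].
  rewrite (coord_vbasis xU); apply: summx_sub => i _; apply: scalemx_sub.
  have lt_ir : (i < r)%N by rewrite -dU.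
  have -> : (vbasis (gsub U v))`_i = row (Ordinal lt_ir) A by rewrite rowK.
  exact: row_sub.
rewrite mulmx_sum_row; apply: memv_suml => i _; apply: memvZ; rewrite rowK.
by apply/vbasis_mem/mem_nth; rewrite size_tuple dU.
Qed.

Lemma frame_mul U A (G : V -> 'M[F]_r) :
  (forall v, G v \in unitmx) -> frame U A -> frame U (fun v => G v *m A v).
Proof.
move=> Gu fA v x; rewrite fA; have /row_fullP[H HG] : row_full (G v).
  by rewrite row_full_unit.
apply/idP/idP => /submxP[D ->]; last by rewrite mulmxA submxMl.
by rewrite -[X in D *m X]mul1mx -HG -mulmxA mulmxA submxMl.
Qed.

Lemma frame_unique U A A' : frame U A -> frame U A' ->
  exists2 G : V -> 'M[F]_r,
    forall v, G v \in unitmx & forall v, A' v = G v *m A v.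
Proof.
move=> fA fA'.
have H v : exists G : 'M[F]_r, G \in unitmx /\ A' v = G *m A v.
  have /eqmxMunitP[G Gu ->] : (A' v == A v)%MS; last by exists G.
  apply/andP; split; apply/row_subP => i.
    by rewrite -fA fA' row_sub.
  by rewrite -fA' fA row_sub.
by have [G HG] := choice H; exists G => v; case: (HG v).
Qed.

Definition rescale (G : V -> 'M[F]_r) (P : plucker_poly) : plucker_poly :=
  mpoly.comp_mpoly
    [tuple (\det (G (enum_val i).1) *: mpoly.mpolyX F (mpoly.mnm1 i))
       | i < #|{: plucker_index}|] P.

Lemma rescaleE G P A : mpoly.meval (plucker A) (rescale G P) =
  mpoly.meval (plucker (fun v => G v *m A v)) P.
Proof.
rewrite /rescale mpoly.comp_mpoly_meval; apply: mpoly.meval_eq => i.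
rewrite tnth_mktuple mpoly.mevalZ mpoly.mevalXU /plucker -det_mulmx.
by congr (\det _); apply/matrixP => a b; rewrite !mxE; apply: eq_bigr => k _;
  rewrite !mxE.
Qed.

Lemma zopenT : zopen setT.
Proof.
exists setT; apply/esym; rewrite -[RHS]setCK; congr (~` _); rewrite setCT.
apply/seteqP; split=> // U /(_ 1 I); have [A fA] := frame_exists U.
by move=> /(_ A fA) /eqP; rewrite mpoly.meval1 oner_eq0.
Qed.

Lemma zopenI : setI_closed zopen.
Proof.
move=> _ _ [S1 ->] [S2 ->]; rewrite -setCU.
exists [set P | forall U, (zlocus S1 `|` zlocus S2) U -> vanishes P U].
congr (~` _); apply/seteqP; split=> [U ZU P /(_ U)|U ZU]; first exact.
apply: contrapT => /not_orP[].
move=> /existsNP[P /not_implyP[S1P /existsNP[A /not_implyP[fA nzP]]]].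
move=> /existsNP[Q /not_implyP[S2Q /existsNP[A' /not_implyP[fA' nzQ]]]].
have [G Gu AE] := frame_unique fA' fA.
have /(_ A' fA')/eqP : vanishes (rescale G P * Q) U.
  apply: ZU => W [WS1|WS2] C fC; rewrite mpoly.mevalM.
    by rewrite rescaleE (WS1 P S1P _ (frame_mul Gu fC)) mul0r.
  by rewrite (WS2 Q S2Q C fC) mulr0.
rewrite mpoly.mevalM mulf_eq0 => /orP[]/eqP; last exact: nzQ.
rewrite rescaleE => PE; apply: nzP; rewrite -[RHS]PE.
by congr (mpoly.meval (plucker _) _); apply/funext => v; rewrite AE.
Qed.

Lemma zopen_bigU (I : Type) (f : I -> set grprod) :
  (forall i, zopen (f i)) -> zopen (\bigcup_i f i).
Proof.
move=> /choice[S SE]; exists (\bigcup_i S i).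
rewrite -[LHS]setCK setC_bigcup; congr (~` _).
apply/seteqP; split=> U ZU.
  by move=> P [i _ SP]; have := ZU i Logic.I; rewrite SE setCK; exact.
by move=> i _; rewrite SE setCK => P SP; apply: ZU; exists i.
Qed.

HB.instance Definition _ := Choice.on grprod.
HB.instance Definition _ :=
  isOpenTopological.Build grprod zopenT zopenI zopen_bigU.

End GrassmannianProduct.

Definition irreducible_set (T : topologicalType) (A : set T) : Prop :=
  A !=set0 /\
  forall C D : set T, closed C -> closed D -> A `<=` C `|` D ->
    A `<=` C \/ A `<=` D.

Definition irreducible_component (T : topologicalType) (A : set T) : Prop :=
  irreducible_set A /\
  forall A' : set T, irreducible_set A' -> A `<=` A' -> A' = A.

Section Configuration.
Variables (R : idomainType) (pi : R) (F : fieldType) (res : {rmorphism R -> F}).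
Variables (V : finType) (d : nat) (B : V -> 'M[{fraction R}]_d).

Local Notation L v := (lat (B v)).
Local Notation piK := (FracField.tofrac pi).

Definition distinct_classes : Prop :=
  forall u v, homothetic (L u) (L v) -> u = v.

Definition convex_config : Prop :=
  forall u v L1 L2, homothetic (L u) L1 -> homothetic (L v) L2 ->
  exists w, homothetic (L w) (L1 `&` L2).

Definition pi_incl (k : int) (u v : V) : Prop :=
  forall x, L u x -> L v (piK ^ k *: x).

Definition nmin (u v : V) : int :=
  xget 0 [set n | pi_incl n u v /\ forall m, pi_incl m u v -> n <= m].

(* Residue of an element of K that lies in R (and junk otherwise). *)
Definition redK (x : {fraction R}) : F :=
  res (xget 0 [set a | FracField.tofrac a = x]).

(* L_v / pi L_v is identified with F^d through the basis of L_v formed by the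
   rows of B v.  For pi_incl k u v, the matrix pi^k B_u B_v^-1 has entries in R
   and expresses multiplication by pi^k from L_u to L_v in the chosen bases
   (acting on row vectors), so that the map below is the one induced on
   L_u / pi L_u -> L_v / pi L_v. *)
Definition mulpi (k : int) (u v : V) : 'End('rV[F]_d) :=
  linfun (mulmxr (map_mx redK (piK ^ k *: (B u *m invmx (B v))))).

Definition fbar (u v : V) : 'End('rV[F]_d) := mulpi (nmin u v) u v.

Definition factors_through (u w v : V) : Prop :=
  fbar u v = (fbar w v \o fbar u w)%VF.

Definition locally_weakly_independent_at (v : V) : Prop :=
  exists I : {set V},
    [/\ v \notin I,
        forall u, u != v -> exists2 w, w \in I & factors_through u w v,
        forall w, w \in I -> limg (fbar w v) = lker (fbar v w) &
        directv (\sum_(w in I) limg (fbar w v))].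

Definition locally_weakly_independent : Prop :=
  convex_config /\ forall v, locally_weakly_independent_at v.

Definition Mrep (E : rel V) : qrep F E :=
  @QRep F V E (fun _ => 'rV[F]_d) (fun u v _ => fbar u v).

Definition Qfull : rel V := fun u v => u != v.

Definition QGamma : rel V := fun u v =>
  (u != v) &&
  ~~ `[< exists p : qpath Qfull u v,
         (2 <= qlength p)%N /\ qcomp (Mrep Qfull) p =1 fbar u v >].

Variable r : nat.
Notation X := (grprod F V d r).

(* Special fiber of the linked Grassmannian, as the closed subset of its
   F-points in the product of Grassmannians. *)
Definition LG0_set : set X :=
  [set U | forall u v k, pi_incl k u v ->
             (mulpi k u v @: gsub U u <= gsub U v)%VS].

Definition quiver_grassmannian : set X :=
  [set U | forall u v, QGamma u v -> (fbar u v @: gsub U u <= gsub U v)%VS].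

Definition LG0 : topologicalType := set_type LG0_set.

(* The structure maps are the restrictions of those of Mrep as soon as U
   belongs to quiver_grassmannian. *)
Definition subrep (U : X) : qrep F QGamma :=
  @QRep F V QGamma (fun v => subvs_of (gsub U v))
    (fun u v _ => vsproj (gsub U v) \o fbar u v \o vsval).

Definition projective_point (U : LG0) : Prop :=
  projective_mod (Mrep QGamma) (subrep (set_val U)).

Definition stratum (U : LG0) : set LG0 :=
  [set W : LG0 | qiso (subrep (set_val W)) (subrep (set_val U))].

Definition rank_vector (U : LG0) (u v : V) : nat :=
  \dim (fbar u v @: gsub (set_val U) u)%VS.

Definition maximal_rank_vector (U : LG0) : Prop :=
  forall W : LG0, (forall u v, (rank_vector U u v <= rank_vector W u v)%N) ->
    rank_vector W = rank_vector U.

End Configuration.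

(* Main.v *)
(* Write u -> w -> v when f_{u,v} factors through w. Local weak independence
   splits the vertices other than v into branches, one for each w in I_v, so
   that a path between different branches passes through v, and makes the
   kernels of the maps f_{v,e} nested when e runs over one branch.

   A subrepresentation U is a sum of the projectives P_v iff it is torsion free:
   no vector of U_s outside the images of the other U_a is killed by a map
   f_{s,v}. A generating set of U has sum_v (r - sum_{w in I_v} rk_{w,v}(U))
   elements, which is at least r with equality in the projective case; hence a
   rank vector dominating that of a projective U is that of a representation
   isomorphic to U.

   If U is not torsion free, choose x in U_s, outside those images, killed by
   f_{s,v} with v adjacent to s and minimal. A dimension count gives z with
   f_{s,v}(z) in U_v but not in f_{s,v}(U_s). The line spanned by x is split off
   by functionals phi_b on the U_b, and y |-> y + t phi_b(y) f_{s,b}(z) moves U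
   inside the linked Grassmannian and increases its rank vector for generic t.
   Density and maximality follow. The stratum of a projective U is open, because
   it is cut out by lower bounds on ranks, and irreducible, because two of its
   points are joined by the line through their generators. *)

From HB Require Import structures.
Require Import Defs.
From mathcomp Require Import all_boot all_order all_algebra all_fingroup.
From mathcomp Require Import generic_quotient ring zify.
From mathcomp Require Import boolp classical_sets functions topology.
From mathcomp Require mpoly.
Import -(notations) mpoly.

Set Implicit Arguments.
Unset Strict Implicit.
Unset Printing Implicit Defensive.

Import GRing.Theory.

Local Open Scope classical_set_scope.
Local Open Scope ring_scope.

(** * Systems of linear maps *)

(** Lengths do not enter the abstract axioms [lwi_maps]: a composite is either [f u v] or zero, and
    the first case, a geodesic, stands for additivity of lengths. The obstacle is to extend a
    functional from [U s] to the other vertices compatibly with the maps. At [b] it descends along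
    [f b e] only if it kills [U b :&: lker (f b e)], and this has to hold for all later [e] at once.
    On one branch these kernels form a chain, so the largest one decides; different branches are
    independent, so the choices glue. The same extension serves twice. On all vertices it proves
    that the generators of a torsion-free [U] are independent. A generating set has at least [r]
    elements because it spans each [U b], of dimension [r]. *)

Section Functionals.
Variables (F : fieldType) (vT : vectType F).
Implicit Types (U K : {vspace vT}) (x y : vT).

Lemma functional_neq0 x : x != 0 -> exists phi : 'Hom(vT, F^o), phi x = 1.
Proof.
move=> nzx; pose X := vbasis {:vT}.
have [i nzi] : exists i, coord X i x != 0.
  apply/existsP; apply: contraNT nzx => /existsPn x0.
  rewrite (coord_vbasis (memvf x)) big1 // => i _.
  by have /negPn/eqP := x0 i; rewrite /X => ->; rewrite scale0r.
exists ((coord X i x)^-1 *: linfun (coord X i : vT -> F^o)).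
by rewrite scale_lfunE lfunE; exact: mulVf.
Qed.

Lemma functional_sep K x : x \notin K ->
  exists phi : 'Hom(vT, F^o), phi x = 1 /\ {in K, forall y, phi y = 0}.
Proof.
move=> xK; have nz : (\1 - projv K)%VF x != 0.
  rewrite add_lfunE opp_lfunE id_lfunE subr_eq0.
  by apply: contraNneq xK => ->; apply: memv_proj.
have [phi phix] := functional_neq0 nz.
exists (phi \o (\1 - projv K))%VF; split=> [|y yK]; first by rewrite comp_lfunE.
by rewrite comp_lfunE add_lfunE opp_lfunE id_lfunE projv_id // subrr linear0.
Qed.

(** The pseudo-inverse of [g \o projv U] need not return [y]; projected to [U], its value differs
    from [y] by a vector of [U :&: lker g], which [phi] kills. *)
Lemma functional_factor (wT : vectType F) (g : 'Hom(vT, wT)) U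
    (phi : 'Hom(vT, F^o)) :
  {in (U :&: lker g)%VS, forall y, phi y = 0} ->
  exists chi : 'Hom(wT, F^o), {in U, forall y, chi (g y) = phi y}.
Proof.
move=> phi0; set h := (g \o projv U)%VF.
exists (phi \o projv U \o h^-1)%VF => y yU; rewrite !comp_lfunE /=.
have gyE : g y = h y by rewrite comp_lfunE projv_id.
have hh : h (h^-1%VF (g y)) = g y by rewrite gyE limg_lfunVK // memv_img ?memvf.
apply/eqP; rewrite -subr_eq0 -linearB; apply/eqP/phi0.
rewrite memv_cap memvB ?memv_proj //= memv_ker linearB /= subr_eq0.
by rewrite -{2}hh comp_lfunE.
Qed.

Lemma functional_glue (I : finType) (P : pred I) (W : I -> {vspace vT})
    (psi : I -> 'Hom(vT, F^o)) :
  directv (\sum_(i | P i) W i) ->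
  exists phi : 'Hom(vT, F^o), forall i, P i -> {in W i, phi =1 psi i}.
Proof.
move=> dW; pose p i := sumv_pi (\sum_(j | P j) W j)%VS i.
exists (\sum_(i | P i) (psi i \o p i))%VF => i Pi x xW.
have xS : x \in (\sum_(j | P j) W j)%VS by rewrite memvE (sumv_sup i) -?memvE.
pose u j := p j x; pose v j := if j == i then x else 0.
have uv : \sum_(j | P j) u j == \sum_(j | P j) v j.
  rewrite (sumv_pi_sum erefl xS) [X in _ == X](bigD1 i) //= /v eqxx.
  by rewrite big1 ?addr0 // => j /andP[_ /negPf->].
have vW j : P j -> v j \in W j.
  by rewrite /v; case: eqP => [-> //|_ _]; apply: mem0v.
have uW j : P j -> u j \in W j by move=> _; apply: memv_sum_pi.
rewrite (directv_sum_unique dW _ _ uW vW) in uv.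
rewrite sum_lfunE (bigD1 i) //= big1 ?addr0 => [|j /andP[Pj ji]].
  by rewrite comp_lfunE; move/forall_inP: uv => /(_ i Pi)/eqP; rewrite /u/v eqxx => ->.
rewrite comp_lfunE; move/forall_inP: uv => /(_ j Pj)/eqP; rewrite /u/v (negPf ji).
by move=> ->; rewrite linear0.
Qed.

End Functionals.

Section LinkedMaps.
Variables (F : fieldType) (V : finType) (vT : vectType F).
Variable f : V -> V -> 'End(vT).

(* For a lattice configuration: [n_{u,v} = n_{u,w} + n_{w,v}]. *)
Definition geo (u w v : V) : bool := f u v == (f w v \o f u w)%VF.

(* For lattices: [pi L_s < L_z < L_s] for suitable representatives. *)
Definition adj (s z : V) : Prop :=
  [/\ z != s, lker (f s z) = limg (f z s), lker (f z s) = limg (f s z)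
    & forall w, w != s -> geo z w s -> geo s z w].

(* In [lwi_adj], for lattices with [L_u < L_v] and [L_u] not in [pi L_v], the
   vertex [z] is the class of the intersection of [L_u] and [pi L_v]. *)
Record lwi_maps (I : V -> {set V}) : Prop := LwiMaps {
  lwi_id : forall u, f u u = \1%VF;
  lwi_neq0 : forall u v, f u v != 0;
  lwi_comp : forall u w v, ~~ geo u w v -> (f w v \o f u w)%VF = 0;
  lwi_loop : forall u w, geo u w u -> u = w;
  lwi_adj : forall u v, u != v ->
    exists z, [/\ adj u z, geo u z v, geo v z u & lker (f u v) = limg (f z u)];
  lwi_notin : forall v, v \notin I v;
  lwi_branch : forall u v, u != v -> exists2 w, w \in I v & geo u w v;
  lwi_directv : forall v, directv (\sum_(w in I v) limg (f w v)) }.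

Variable I : V -> {set V}.
Hypothesis Hf : lwi_maps I.

Lemma geoE u w v x : geo u w v -> f w v (f u w x) = f u v x.
Proof. by move=> /eqP->; rewrite comp_lfunE. Qed.

Lemma ngeoE u w v x : ~~ geo u w v -> f w v (f u w x) = 0.
Proof. by move=> /(lwi_comp Hf); rewrite -comp_lfunE => ->; rewrite zero_lfunE. Qed.

Lemma fid u x : f u u x = x.
Proof. by rewrite (lwi_id Hf) id_lfunE. Qed.

Lemma f_nonzero u v : exists x, f u v x != 0.
Proof.
apply: contrapT => nx; case/eqP: (lwi_neq0 Hf u v); apply/lfunP => x.
by rewrite zero_lfunE; apply/eqP/negPn/negP => nzx; apply: nx; exists x.
Qed.

Lemma geo_sl u v : geo u u v.
Proof. by apply/eqP/lfunP => x; rewrite comp_lfunE fid. Qed.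

Lemma geo_sr u v : geo u v v.
Proof. by apply/eqP/lfunP => x; rewrite comp_lfunE fid. Qed.

Lemma geo_from u w v : (forall x, f w v (f u w x) = f u v x) -> geo u w v.
Proof. by move=> h; apply/eqP/lfunP => x; rewrite comp_lfunE h. Qed.

Lemma geo_intro u w v x : f w v (f u w x) != 0 -> geo u w v.
Proof. by apply: contraNT => /ngeoE->. Qed.

(** A composite that is nonzero at one vector is geodesic by [lwi_comp], so it suffices to follow
    some [x] with [f u v x != 0]. *)
Lemma geo_prefix u a w v : geo u w v -> geo u a w -> geo u a v /\ geo a w v.
Proof.
move=> uwv uaw; have awv : geo a w v.
  have [x nzx] := f_nonzero u v; apply: (@geo_intro _ _ _ (f u a x)).
  by rewrite (geoE _ uaw) (geoE _ uwv).
by split=> //; apply: geo_from => x; rewrite -(geoE _ awv) (geoE _ uaw) geoE.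
Qed.

Lemma geo_suffix u a w v : geo u w v -> geo w a v -> geo u a v /\ geo u w a.
Proof.
move=> uwv wav; have uwa : geo u w a.
  have [x nzx] := f_nonzero u v; apply: (@geo_intro _ _ _ x).
  by apply: contraNneq nzx => wa0; rewrite -(geoE _ uwv) -(geoE _ wav) wa0 linear0.
by split=> //; apply: geo_from => x; rewrite -(geoE _ uwa) (geoE _ wav) geoE.
Qed.

Lemma geo_antil a a' b : geo a a' b -> geo a' a b -> a = a'.
Proof. by move=> h /(geo_suffix h)[_ /(lwi_loop Hf)]. Qed.

Lemma geo_antir s a b : geo s a b -> geo s b a -> a = b.
Proof. by move=> h /(geo_prefix h)[_ /(lwi_loop Hf)]. Qed.

(** Substitutes for lengths in inductions: [before s b] grows as [b] moves away from [s], and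
    [after c b] grows as [c] approaches [b]. *)
Definition before s b := #|[pred a | geo s a b]|.
Definition after c b := #|[pred a | geo a c b]|.

Lemma before_lt s a b : geo s a b -> a != b -> (before s a < before s b)%N.
Proof.
move=> sab nab; apply/proper_card/fintype.properP; split.
  by apply/fintype.subsetP => c; rewrite !inE => /(geo_prefix sab)[].
exists b; rewrite !inE ?geo_sr //; apply: contra nab => /(geo_antir sab)->.
exact: eqxx.
Qed.

Lemma after_lt c c1 b : geo c c1 b -> c != c1 -> (after c b < after c1 b)%N.
Proof.
move=> cab nab; apply/proper_card/fintype.properP; split.
  by apply/fintype.subsetP => a; rewrite !inE => /geo_suffix/(_ cab)[].
by exists c1; rewrite !inE ?geo_sl //; apply: contra nab => /(geo_antil cab)->.
Qed.

Lemma after_le a b : (after a b <= #|V|)%N.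
Proof. exact: max_card. Qed.

Lemma limg_geo u w v : geo u w v -> (limg (f u v) <= limg (f w v))%VS.
Proof. by move=> /eqP->; rewrite limg_comp limgS ?subvf. Qed.

Lemma branch_inj v c c' x : c \in I v -> c' \in I v -> x != 0 ->
  x \in limg (f c v) -> x \in limg (f c' v) -> c = c'.
Proof.
move=> cI c'I nzx xc xc'; apply/eqP; apply: contraNT nzx => ncc'.
have /directv_sumP/(_ c cI) := lwi_directv Hf v.
move=> /(congr1 (fun W : {vspace vT} => x \in W)); rewrite memv_cap memv0 => <-.
by rewrite xc memvE (sumv_sup c') -?memvE // c'I eq_sym.
Qed.

(** The nonzero image of [f a v] would lie in the images of both branches, which independence
    forbids for distinct ones. *)
Lemma branch_uniq a v c c' : c \in I v -> c' \in I v ->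
  geo a c v -> geo a c' v -> c = c'.
Proof.
move=> cI c'I /limg_geo/subvP ac /limg_geo/subvP ac'.
have [x nzx] := f_nonzero a v; apply: (branch_inj cI c'I nzx).
  by apply/ac/memv_img/memvf.
by apply/ac'/memv_img/memvf.
Qed.

(** The kernel is the image of a neighbour [z] of [b] through which [e] reaches [b]; hence [z] and
    [e] share their branch. *)
Lemma lker_branch b e c : c \in I b -> e != b -> geo e c b ->
  (lker (f b e) <= limg (f c b))%VS.
Proof.
move=> cI eb ecb; have [|z [[zb _ _ _] _ ezb ->]] := lwi_adj Hf (u := b) (v := e).
  by rewrite eq_sym.
have [c' c'I zc'b] := lwi_branch Hf zb.
have [ec'b _] := geo_suffix ezb zc'b.
by rewrite (branch_uniq cI c'I ecb ec'b); apply: limg_geo.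
Qed.

(* Descend along the branches inside the segment from [b] to [b]: as long as
   [c] is neither [z] nor [z'], both factor through the same branch at [c]. *)
Lemma adj_nested b w z z' : adj b z -> adj b z' -> w \in I b ->
  geo z w b -> geo z' w b -> geo z z' b \/ geo z' z b.
Proof.
move=> [zb _ _ zadj] [z'b _ _ z'adj] wI zwb z'wb.
have wb : w != b by apply: contraTneq wI => ->; apply: lwi_notin Hf _.
have: [/\ geo z w b, geo z' w b, geo b z w & geo b z' w].
  by split=> //; [exact: zadj | exact: z'adj].
move: w {wI zwb z'wb} wb.
suff H n w : w != b -> (after w b <= n)%N ->
    [/\ geo z w b, geo z' w b, geo b z w & geo b z' w] ->
    geo z z' b \/ geo z' z b.
  by move=> w wb; apply: (H #|V|); rewrite ?after_le.
elim: n w => [|n IHn] w wb.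
  by rewrite leqn0 => /eqP/card0_eq/(_ w); rewrite inE /= geo_sl.
move=> len [zw z'w bz bz'].
have [zeq|nz] := eqVneq z w; first by subst w; right.
have [zeq|nz'] := eqVneq z' w; first by subst w; left.
have [c cI zc] := lwi_branch Hf nz; have [c' c'I z'c] := lwi_branch Hf nz'.
have [bc _] := geo_suffix bz zc; have [bc' _] := geo_suffix bz' z'c.
have ecc := branch_uniq cI c'I bc bc'; subst c'.
have [zcb cwb] := geo_prefix zw zc; have [z'cb _] := geo_prefix z'w z'c.
have [_ bzc] := geo_suffix bz zc; have [_ bz'c] := geo_suffix bz' z'c.
have cw : c != w by apply: contraTneq cI => ->; apply: lwi_notin Hf _.
have cb : c != b.
  apply: contraNneq zb => ecb; subst c; apply/eqP/esym.
  exact: (lwi_loop Hf bzc).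
apply: (IHn c) => //; rewrite -ltnS; apply: leq_trans len; exact: after_lt.
Qed.

(** Both kernels are images of neighbours of [b] in the branch [w], and [adj_nested] makes one of
    these neighbours factor through the other. *)
Lemma lker_nested b w e e' : w \in I b -> e != b -> e' != b ->
  geo e w b -> geo e' w b ->
  (lker (f b e) <= lker (f b e'))%VS \/ (lker (f b e') <= lker (f b e))%VS.
Proof.
move=> wI eb e'b ew e'w.
have [|z [adjz _ ezb ->]] := lwi_adj Hf (u := b) (v := e); first by rewrite eq_sym.
have [|z' [adjz' _ e'z'b ->]] := lwi_adj Hf (u := b) (v := e').
  by rewrite eq_sym.
have br x a : adj b x -> geo a x b -> geo a w b -> geo x w b.
  move=> [xb _ _ _] axb awb; have [c cI xcb] := lwi_branch Hf xb.
  by have [acb _] := geo_suffix axb xcb; rewrite (branch_uniq wI cI awb acb).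
have [] := adj_nested adjz adjz' wI (br _ _ adjz ezb ew) (br _ _ adjz' e'z'b e'w).
  by left; apply: limg_geo.
by right; apply: limg_geo.
Qed.

End LinkedMaps.

(** * Extension of functionals along a subrepresentation *)

Section Subrepresentations.
Variables (F : fieldType) (V : finType) (vT : vectType F).
Variables (f : V -> V -> 'End(vT)) (I : V -> {set V}).
Hypothesis Hf : lwi_maps f I.
Variable U : V -> {vspace vT}.
Hypothesis HU : forall a b, (f a b @: U a <= U b)%VS.

Local Notation geo := (geo f).

(** The part at [s] of the radical of [U]: a basis of a complement in [U s] is a minimal set of
    generators placed at [s]. *)
Definition radv (s : V) : {vspace vT} := (\sum_(a | a != s) f a s @: U a)%VS.

Definition torsion_free : Prop :=
  forall s v, s != v -> (U s :&: lker (f s v) <= radv s)%VS.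

Lemma mem_f a b y : y \in U a -> f a b y \in U b.
Proof. by move=> yU; apply: (subvP (HU a b)); apply: memv_img. Qed.

Lemma mem_rad a s y : a != s -> y \in U a -> f a s y \in radv s.
Proof. by move=> nas yU; rewrite memvE (sumv_sup a) // -memvE memv_img. Qed.

Section Extension.
Variables (S : pred V) (s : V) (phi0 : 'Hom(vT, F^o)).
Hypothesis S_prefix : forall a b, geo s a b -> S b -> S a.
Hypothesis phi0_rad : forall a, a != s -> {in U a, forall y, phi0 (f a s y) = 0}.
Hypothesis phi0_ker : forall b, S b ->
  {in (U s :&: lker (f s b))%VS, forall y, phi0 y = 0}.

(** The second clause is the invariant that keeps the construction going: it is the condition for
    [phi b] to descend to the vertices [e] beyond [b]. *)
Let extends_at (phi : V -> 'Hom(vT, F^o)) b :=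
  (forall a, {in U a, forall y, phi b (f a b y) = if geo s a b then phi a y else 0})
  /\ (forall e, S e -> geo s b e ->
      {in (U b :&: lker (f b e))%VS, forall y, phi b y = 0}).

(* Among the vertices [e] of [S] beyond [b] whose kernel lies in the branch [w]
   through which [s] reaches [b] (or [e = b]), choose one of largest kernel;
   on that branch the new functional is pulled back from [e]. *)
Let extend_step (phi : V -> 'Hom(vT, F^o)) b : S b -> b != s ->
  (forall c, S c -> (before f s c < before f s b)%N -> extends_at phi c) ->
  exists psi : 'Hom(vT, F^o),
    (forall a, a != b ->
      {in U a, forall y, psi (f a b y) = if geo s a b then phi a y else 0})
  /\ (forall e, S e -> geo s b e ->
      {in (U b :&: lker (f b e))%VS, forall y, psi y = 0}).
Proof.
move=> Sb bs IH; have [|w wI swb] := lwi_branch Hf (u := s) (v := b).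
  by rewrite eq_sym.
have Sw : S w := S_prefix swb Sb.
have wb : w != b by apply: contraTneq wI => ->; apply: lwi_notin Hf _.
have [phiw1 phiw2] := IH w Sw (before_lt Hf swb wb).
pose E e := [&& S e, geo s b e & (e == b) || geo e w b].
have Eb : E b by rewrite /E Sb (geo_sr Hf) eqxx.
have [e /and3P[Se sbe eE] emax] :
    exists2 e, E e & forall e', E e' -> (lker (f b e') <= lker (f b e))%VS.
  (* The kernels in question form a chain, so largest dimension means largest for inclusion. *)
  case: (arg_maxnP (fun e => \dim (lker (f b e))) Eb) => e Ee emax.
  exists e => // e' Ee'.
  have ker_bb : lker (f b b) = 0%VS.
    apply/eqP; rewrite -subv0; apply/subvP => y.
    by rewrite memv_ker (fid Hf) => /eqP->; apply: mem0v.
  have [->|e'b] := eqVneq e' b; first by rewrite ker_bb sub0v.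
  have [eb|eb] := eqVneq e b.
    have := emax _ Ee'; rewrite /= eb ker_bb dimv0 leqn0 dimv_eq0 => /eqP->.
    exact: sub0v.
  case/and3P: Ee => _ _; rewrite (negPf eb) /= => ewb.
  have := Ee'; case/and3P => _ _; rewrite (negPf e'b) /= => e'wb.
  have [h|//] := lker_nested Hf wI eb e'b ewb e'wb.
  have /eqP -> // : lker (f b e) == lker (f b e').
  by rewrite eqEdim h; apply: emax.
have [swe wbe] := geo_prefix Hf sbe swb.
(* The invariant at [w] lets [phi w] factor through [f w e]. Since [w], [b], [e] is geodesic,
   [chi \o f b e] takes the prescribed values on [f w b @: U w]. *)
have [|chi chiE] := functional_factor (g := f w e) (U := U w) (phi := phi w).
  exact: phiw2.
pose psi c := if c == w then (chi \o f b e)%VF else 0.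
have [psi' psi'E] := functional_glue psi (lwi_directv Hf b).
exists psi'; split=> [a ab y yU|e' Se' sbe' y].
  have [c cI acb] := lwi_branch Hf ab.
  rewrite (psi'E c cI) -?(geoE _ acb) ?memv_img ?memvf // /psi.
  have [cw|cw] := eqVneq c w; last first.
    rewrite zero_lfunE; case: ifP => // sab.
    have [scb _] := geo_suffix Hf sab acb.
    by case/eqP: cw; apply: (branch_uniq Hf cI wI scb swb).
  subst c; rewrite comp_lfunE (geoE _ wbe) chiE ?mem_f // phiw1 //.
  suff -> : geo s a w = geo s a b by [].
  apply/idP/idP => [/(geo_prefix Hf swb)[]//|sab].
  by have [] := geo_suffix Hf sab acb.
rewrite memv_cap => /andP[yU yk].
have [eb'|e'b] := eqVneq e' b.
  by move: yk; rewrite eb' memv_ker (fid Hf) => /eqP->; rewrite linear0.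
have [c cI e'cb] := lwi_branch Hf e'b.
rewrite (psi'E c cI) ?(subvP (lker_branch Hf cI e'b e'cb)) // /psi.
case: eqP => [cw|_]; last by rewrite zero_lfunE.
rewrite comp_lfunE; have -> : f b e y = 0; last by rewrite linear0.
apply/eqP; rewrite -memv_ker; apply: (subvP (emax e' _)) yk.
by rewrite /E Se' sbe' -cw e'cb orbT.
Qed.

(* [phi] is a morphism from [U] to the quotient supported on [S] of the
   projective generated at [s]. *)
Lemma extend_functional : exists phi : V -> 'Hom(vT, F^o), phi s = phi0 /\
  forall b, S b -> forall a, {in U a, forall y,
    phi b (f a b y) = if geo s a b then phi a y else 0}.
Proof.
suff [phi [phis phiP]] : exists phi : V -> 'Hom(vT, F^o), phi s = phi0 /\
    forall b, S b -> (before f s b < #|V|.+1)%N -> extends_at phi b.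
  by exists phi; split=> // b /phiP[]//; rewrite ltnS max_card.
elim: #|V|.+1 => [|n [phi [phis phiP]]]; first by exists (fun=> phi0).
have H b : exists psi : 'Hom(vT, F^o), if b == s then psi = phi0 else
    (S b /\ before f s b = n) ->
    (forall a, a != b ->
      {in U a, forall y, psi (f a b y) = if geo s a b then phi a y else 0})
  /\ (forall e, S e -> geo s b e ->
      {in (U b :&: lker (f b e))%VS, forall y, psi y = 0}).
  case: eqVneq => [_|bs]; first by exists phi0.
  have [[Sb bn]|nb] := pselect (S b /\ before f s b = n); last by exists 0 => /nb.
  have [|psi psiP] := extend_step (phi := phi) Sb bs; last by exists psi.
  by rewrite bn.
have [psi psiP] := choice H.
(* Stage [n] only touches the vertices with [before f s b = n]; the values it relies on have a
   smaller [before] and stay fixed. *)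
pose phi' b := if before f s b == n then psi b else phi b.
have phi's : phi' s = phi0.
  by rewrite /phi'; case: eqP => // _; have := psiP s; rewrite eqxx.
exists phi'; split=> // b Sb; rewrite ltnS leq_eqVlt => /orP[/eqP bn|bn].
  have phi'a a : geo s a b -> a != b -> phi' a = phi a.
    by move=> sab ab; rewrite /phi' ltn_eqF // -bn (before_lt Hf).
  have [bs|bs] := eqVneq b s.
    subst b; split=> [a y yU|e Se _]; last by rewrite phi's; apply: phi0_ker.
    have [->|as_] := eqVneq a s; first by rewrite (fid Hf) (geo_sl Hf).
    rewrite phi's phi0_rad //; case: ifP => // /(lwi_loop Hf) sa.
    by rewrite sa eqxx in as_.
  have := psiP b; rewrite (negPf bs) => /(_ (conj Sb bn))[psi1 psi2].
  have phi'b : phi' b = psi b by rewrite /phi' bn eqxx.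
  split=> [a y yU|e Se sbe]; last by rewrite phi'b; apply: psi2.
  have [->|ab] := eqVneq a b; first by rewrite (fid Hf) (geo_sr Hf).
  by rewrite phi'b psi1 //; case: ifP => // sab; rewrite phi'a.
have [p1 p2] := phiP b Sb bn.
have phi'E a : (before f s a < n)%N -> phi' a = phi a.
  by rewrite /phi' => /ltn_eqF->.
split=> [a y yU|e Se sbe]; last by rewrite phi'E //; apply: p2.
rewrite phi'E // p1 //; case: ifP => // sab; rewrite phi'E //.
have [->//|ab] := eqVneq a b.
exact: ltn_trans (before_lt Hf sab ab) bn.
Qed.

End Extension.

End Subrepresentations.

(** * Deformation of a subrepresentation with torsion *)

Section Deformation.
Variables (F : fieldType) (V : finType) (vT : vectType F).
Variables (f : V -> V -> 'End(vT)) (I : V -> {set V}).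
Hypothesis Hf : lwi_maps f I.
Variable U : V -> {vspace vT}.
Hypothesis HU : forall a b, (f a b @: U a <= U b)%VS.
Variable r : nat.
Hypothesis dimU : forall v, \dim (U v) = r.

Local Notation geo := (geo f).
Local Notation radv := (radv f U).

(** Minimal [after f v s] selects, within its branch, the smallest kernel with torsion outside the
    radical. Every [b] of that branch with such torsion is then reached from [s] through [v], so it
    is removed together with the vertices beyond [v]. *)
Lemma torsion_adj : ~ torsion_free f U -> exists s v,
  [/\ adj f s v, ~~ (U s :&: lker (f s v) <= radv s)%VS &
    forall b, b != s -> ~~ (U s :&: lker (f s b) <= radv s)%VS ->
      forall w, w \in I s -> geo v w s -> geo b w s -> geo s v b].
Proof.
move=> /existsNP[s /existsNP[v0 /not_implyP[sv0 /negP nsub]]].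
have toadj b : b != s -> ~~ (U s :&: lker (f s b) <= radv s)%VS ->
    exists z, [/\ adj f s z, ~~ (U s :&: lker (f s z) <= radv s)%VS,
      geo s z b & geo b z s].
  move=> bs nb; have [|z [adjz szb bzs kz]] := lwi_adj Hf (u := s) (v := b).
    by rewrite eq_sym.
  by exists z; split=> //; case: adjz => _ -> _ _; rewrite -kz.
pose P z := `[< adj f s z >] && ~~ (U s :&: lker (f s z) <= radv s)%VS.
have [|z0 [adjz0 nz0 _ _]] := toadj v0 _ nsub; first by rewrite eq_sym.
have Pz0 : P z0 by rewrite /P nz0 andbT; apply/asboolP.
case: (arg_minnP (fun z => after f z s) Pz0) => v /andP[/asboolP adjv nv] vmin.
exists s, v; split=> // b bs nb w wI vws bws.
have [z [adjz nz szb bzs]] := toadj b bs nb.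
have Pz : P z by rewrite /P nz andbT; apply/asboolP.
have zs : z != s by case: adjz.
have zws : geo z w s.
  have [c cI zcs] := lwi_branch Hf zs.
  by have [bcs _] := geo_suffix Hf bzs zcs; rewrite (branch_uniq Hf wI cI bws bcs).
have [vzs|zvs] := adj_nested Hf adjv adjz wI vws zws.
  have [_ _ _ /(_ z zs vzs) svz] := adjv.
  by have [] := geo_prefix Hf szb svz.
have [<-//|zv] := eqVneq z v; have := vmin _ Pz.
by rewrite leqNgt (after_lt Hf zvs zv).
Qed.

(** If no such [z] existed, [U v :&: lker (f v s)] would lie in [f s v @: U s]. As [U s] and [U v]
    have the same dimension, rank-nullity would give [f v s @: U v = U s :&: lker (f s v)], and this
    torsion would be in the radical. *)
Lemma exact_defect s v : lker (f v s) = limg (f s v) ->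
  (f v s @: U v <= lker (f s v))%VS -> s != v ->
  ~~ (U s :&: lker (f s v) <= radv s)%VS ->
  exists z, f s v z \in U v /\ f s v z \notin (f s v @: U s)%VS.
Proof.
move=> kvs im_ker sv nsub; apply: contrapT => nz.
have sub1 : (U v :&: lker (f v s) <= f s v @: U s)%VS.
  apply/subvP => y; rewrite memv_cap kvs => /andP[yU /memv_imgP[z _ yE]].
  by apply/negPn/negP => yn; apply: nz; exists z; rewrite -yE.
have d1 := limg_ker_dim (f v s) (U v); have d2 := limg_ker_dim (f s v) (U s).
have le1 := dimvS sub1; rewrite dimU in d1; rewrite dimU in d2.
have sub2 : (f v s @: U v <= U s :&: lker (f s v))%VS by rewrite subv_cap HU.
have /eqP eq2 : (f v s @: U v)%VS == (U s :&: lker (f s v))%VS.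
  rewrite eqEdim sub2 -(leq_add2l (\dim (U v :&: lker (f v s)))) d1 -d2.
  by rewrite addnC leq_add2l.
by case/negP: nsub; rewrite -eq2 /radv (sumv_sup v) // eq_sym.
Qed.

(* The vector [x] of [U s] generating a torsion summand is moved to [x + t z]
   with [f s v z] in [U v]; [phi] carries the motion along to the vertices
   that [x] reaches. *)
Lemma deformation : ~ torsion_free f U ->
  exists s v (phi : V -> 'Hom(vT, F^o)) (u : V -> vT),
  (forall (t : F) a b, {in U a, forall y, exists2 y', y' \in U b &
      f a b (y + t * phi a y *: u a) = y' + t * phi b y' *: u b}) /\
  (forall (t : F) (U' : {vspace vT}), t != 0 ->
     {in U s, forall y, y + t * phi s y *: u s \in U'} ->
     (\dim (f s v @: U s) < \dim (f s v @: U'))%N).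
Proof.
move=> /torsion_adj[s [v [adjv nsub vP]]].
have [vs ksv kvs _] := adjv; have sv : s != v by rewrite eq_sym.
have nsvs : ~~ geo s v s by apply: contra vs => /(lwi_loop Hf)->.
have nvsv : ~~ geo v s v by apply: contra vs => /(lwi_loop Hf)->.
have im_ker : (f v s @: U v <= lker (f s v))%VS.
  by apply/subvP => _ /memv_imgP[y _ ->]; rewrite memv_ker (ngeoE Hf _ nvsv).
have [z [yU yn]] := exact_defect kvs im_ker sv nsub.
have [w wI vws] := lwi_branch Hf vs.
(* [phi0] has to vanish on the radical and on the kernels belonging to branches other than [w]; [K]
   contains both. *)
pose K := (radv s + \sum_(c in I s | c != w) limg (f c s))%VS.
have radE : (radv s <= f w s @: U w + \sum_(c in I s | c != w) limg (f c s))%VS.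
  apply/subv_sumP => a as_; have [c cI acs] := lwi_branch Hf as_.
  apply/subvP => _ /memv_imgP[y ya ->]; rewrite -(geoE _ acs).
  have [<-|cw] := eqVneq c w.
    by apply: (subvP (addvSl _ _)); apply/memv_img/mem_f.
  apply: (subvP (addvSr _ _)); rewrite memvE (sumv_sup c) ?cI // -memvE.
  by rewrite memv_img ?memvf.
have [x xU xk] : exists2 x, x \in U s & x \in lker (f s v) /\ x \notin radv s.
  case/subvPn: nsub => x; rewrite memv_cap => /andP[xU xk] xr.
  by exists x.
case: xk => xk xr.
have xw : x \in limg (f w s).
  by move: xk; rewrite ksv; exact: (subvP (limg_geo vws)).
have ws : w != s by apply: contraTneq wI => ->; apply: lwi_notin Hf _.
(* By independence of the branches, a decomposition of [x] inside [K] only involves the branch [w],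
   which would put [x] in the radical. *)
have xK : x \notin K.
  apply: contra xr => xK.
  have : x \in (f w s @: U w + \sum_(c in I s | c != w) limg (f c s))%VS.
    by apply: (subvP _ _ xK); rewrite subv_add radE addvSr.
  case/memv_addP => g gU [h hU xE].
  have h0 : h \in (limg (f w s) :&: \sum_(c in I s | c != w) limg (f c s))%VS.
    rewrite memv_cap hU andbT (_ : h = x - g) ?memvB //; last by rewrite xE addrC addKr.
    by apply: (subvP _ _ gU); apply/limgS/subvf.
  move: h0; have /directv_sumP/(_ w wI) -> := lwi_directv Hf s.
  rewrite memv0 => /eqP h0; rewrite xE h0 addr0.
  by case/memv_imgP: gU => y yw ->; apply: mem_rad.
have [phi0 [phi0x phi0K]] := functional_sep xK.
(* For [b] outside [S], [f s b z] is the image of [f s v z], which lies in [U v]; the motion there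
   stays inside [U b] and [phi'] may be zero. *)
pose S := [pred u | ~~ geo s v u].
have Ss : S s by [].
have Spre a b : geo s a b -> S b -> S a.
  by rewrite /S /= => sab; apply: contra => sva; case: (geo_prefix Hf sab sva).
have p1 a : a != s -> {in U a, forall y, phi0 (f a s y) = 0}.
  move=> as_ y ya; apply: phi0K; apply: (subvP (addvSl _ _)); exact: mem_rad.
have p2 b : S b -> {in (U s :&: lker (f s b))%VS, forall y, phi0 y = 0}.
  move=> Sb y yk; have [eb|bs] := eqVneq b s.
    move: yk; rewrite eb memv_cap memv_ker (fid Hf) => /andP[_ /eqP->].
    by rewrite linear0.
  have [c cI bcs] := lwi_branch Hf bs.
  have [cw|cw] := eqVneq c w.
    have [sub|nsb] := boolP (U s :&: lker (f s b) <= radv s)%VS.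
      by apply: phi0K; apply: (subvP (addvSl _ _)); apply: (subvP sub).
    by subst c; case/negP: Sb; apply: vP bcs.
  apply: phi0K; apply: (subvP (addvSr _ _)).
  rewrite memvE (sumv_sup c) ?cI // -memvE.
  apply: (subvP (lker_branch Hf cI bs bcs)).
  by move: yk; rewrite memv_cap => /andP[].
have [phi [phis phiP]] := extend_functional Hf HU Spre p1 p2.
pose phi' b := if S b then phi b else 0.
have phi'S b : S b -> phi' b = phi b by rewrite /phi' => ->.
exists s, v, phi', (fun b => f s b z); split=> [t a b y ya|t U' tnz HU'].
  rewrite linearD linearZ /=.
  have [Sb|nSb] := boolP (S b).
    exists (f a b y); first exact: mem_f.
    rewrite (phi'S b Sb) phiP //; case: ifPn => sab.
      by rewrite (geoE _ sab) phi'S //; exact: (Spre _ _ sab Sb).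
    by rewrite (ngeoE Hf _ sab) mulr0 scale0r scaler0.
  exists (f a b y + t * phi' a y *: f a b (f s a z)); last first.
    by rewrite /phi' (negPf nSb) zero_lfunE mulr0 scale0r addr0.
  rewrite memvD ?mem_f // memvZ //.
  have [sab|nsab] := boolP (geo s a b); last by rewrite (ngeoE Hf _ nsab) mem0v.
  by move: nSb; rewrite (geoE _ sab) negbK => /geoE <-; apply: mem_f.
apply: (@leq_trans (\dim (f s v @: U s + <[f s v z]>)%VS)).
  rewrite ltn_neqAle dimvS ?addvSl // andbT; apply: contra yn => /eqP dE.
  have /eqP -> : (f s v @: U s)%VS == (f s v @: U s + <[f s v z]>)%VS.
    by rewrite eqEdim addvSl dE /=.
  by apply: (subvP (addvSr _ _)); apply: memv_line.
have phi's : phi' s = phi0 by rewrite phi'S.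
(* As [f s v x = 0] and [phi0 x = 1], the moved vector [x] is sent to a nonzero multiple of
   [f s v z]. *)
have zU' : f s v z \in (f s v @: U')%VS.
  have := memv_img (f s v) (HU' x xU).
  rewrite linearD linearZ /= phi's phi0x mulr1 (fid Hf).
  move: xk; rewrite memv_ker => /eqP->; rewrite add0r => h.
  by rewrite -[f s v z](scalerK tnz) memvZ.
apply/dimvS; rewrite subv_add -memvE zU' andbT.
apply/subvP => _ /memv_imgP[y ys ->].
have := memv_img (f s v) (HU' y ys); rewrite linearD linearZ /= (fid Hf) => yz.
by rewrite -[f s v y](addrK (t * phi' s y *: f s v z)) memvB // memvZ.
Qed.

End Deformation.

(** * Generators *)

Section RowSpaces.
Variables (F : fieldType) (d : nat).
Implicit Types U : {vspace 'rV[F]_d}.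

Definition spanned_by m U (A : 'M[F]_(m, d)) := forall x, (x \in U) = (x <= A)%MS.

Lemma dim_spanned m U (A : 'M[F]_(m, d)) : spanned_by U A -> \dim U = \rank A.
Proof.
move=> UA; pose b := [tuple row i (row_base A) | i < \rank A].
suff /andP[/eqP <- fr] : basis_of U b by rewrite (eqnP fr) size_tuple.
apply/andP; split.
  rewrite eqEsubv; apply/andP; split.
    apply/span_subvP => _ /mapP[i _ ->].
    by rewrite UA -(eq_row_base A) row_sub.
  apply/subvP => x; rewrite UA -(eq_row_base A) => /submxP[D ->].
  rewrite mulmx_sum_row; apply: memv_suml => i _; apply: memvZ; apply: memv_span.
  by rewrite -(tnth_mktuple (fun i => row i (row_base A)) i) mem_tnth.
apply/freeP => k k0 i; have : \row_i k i *m row_base A = 0.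
  rewrite mulmx_sum_row -[RHS]k0; apply: eq_bigr => j _.
  by rewrite mxE -tnth_nth tnth_mktuple.
move/eqP; rewrite mulmx_free_eq0 ?row_base_free // => /eqP/rowP/(_ i).
by rewrite !mxE.
Qed.

Lemma spanned_img m U (A : 'M[F]_(m, d)) (g : 'End('rV[F]_d)) :
  spanned_by U A -> spanned_by (g @: U)%VS (A *m lin1_mx g).
Proof.
move=> UA x; apply/memv_imgP/submxP => [[y]|[D ->]].
  by rewrite UA => /submxP[D ->] ->; exists D; rewrite mulmxA mul_rV_lin1.
by exists (D *m A); rewrite ?UA ?submxMl // mulmxA mul_rV_lin1.
Qed.

Lemma spanned_rows m (A : 'M[F]_(m, d)) :
  spanned_by <<[tuple row i A | i < m]>>%VS A.
Proof.
move=> y; apply/idP/idP => [|/submxP[D ->]].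
  move=> /coord_span ->; apply: summx_sub => i _; apply: scalemx_sub.
  by rewrite -tnth_nth tnth_mktuple row_sub.
rewrite mulmx_sum_row; apply: memv_suml => i _; apply: memvZ; apply: memv_span.
by rewrite -(tnth_mktuple (fun i => row i A) i) mem_tnth.
Qed.

Lemma spanned_by_full m U (A : 'M[F]_(m, d)) :
  (forall i, row i A \in U) -> (\dim U <= \rank A)%N -> spanned_by U A.
Proof.
move=> AU le x.
have AUs y : (y <= A)%MS -> y \in U.
  move=> /submxP[D ->]; rewrite mulmx_sum_row.
  by apply: memv_suml => i _; apply/memvZ/AU.
pose W : {vspace 'rV[F]_d} := <<[tuple row i A | i < m]>>%VS.
have WA : spanned_by W A := spanned_rows A.
rewrite -WA; suff /eqP -> : W == U by [].
by rewrite eqEdim (dim_spanned WA) le andbT; apply/subvP => y; rewrite WA; apply: AUs.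
Qed.

End RowSpaces.

Section Generators.
Variables (F : fieldType) (V : finType) (d : nat).
Variables (f : V -> V -> 'End('rV[F]_d)) (I : V -> {set V}).
Hypothesis Hf : lwi_maps f I.

Local Notation geo := (geo f).

(* The row [j] of [X] is a generator placed at the vertex [ver j]. *)
Definition genframe m (ver : 'I_m -> V) (X : 'M[F]_(m, d)) (b : V) : 'M[F]_(m, d) :=
  \matrix_j f (ver j) b (row j X).

Lemma row_genframe m (ver : 'I_m -> V) X b j :
  row j (genframe ver X b) = f (ver j) b (row j X).
Proof. exact: rowK. Qed.

Lemma mul_genframe m (ver : 'I_m -> V) X b (c : 'rV_m) :
  c *m genframe ver X b = \sum_j c 0 j *: f (ver j) b (row j X).
Proof. by rewrite mulmx_sum_row; apply: eq_bigr => j _; rewrite row_genframe. Qed.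

Lemma f_row_genframe m (ver : 'I_m -> V) X a b j :
  f a b (row j (genframe ver X a)) =
  if geo (ver j) a b then row j (genframe ver X b) else 0.
Proof.
rewrite !row_genframe; case: ifPn => [|h]; first exact: geoE.
exact: (ngeoE Hf).
Qed.

Section Subrep.
Variable U : V -> {vspace 'rV[F]_d}.
Hypothesis HU : forall a b, (f a b @: U a <= U b)%VS.

Local Notation radv := (radv f U).

Lemma radv_sub u : (radv u <= U u)%VS.
Proof. by apply/subv_sumP => a _; apply: HU. Qed.

Lemma radv_branch u : radv u = (\sum_(w in I u) f w u @: U w)%VS.
Proof.
apply/eqP; rewrite eqEsubv; apply/andP; split; apply/subv_sumP => a aP.
  have [c cI acu] := lwi_branch Hf aP; apply/subvP => _ /memv_imgP[y ya ->].
  by rewrite -(geoE _ acu) memvE (sumv_sup c) // -memvE memv_img ?mem_f.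
by rewrite (sumv_sup a) //; apply: contraTneq aP => ->; apply: lwi_notin Hf _.
Qed.

Lemma dim_radv u : \dim (radv u) = (\sum_(w in I u) \dim (f w u @: U w))%N.
Proof.
rewrite radv_branch; apply/eqP; rewrite -directvE /=.
apply/directv_sum_independent => us Uus.
move/directv_sum_independent: (lwi_directv Hf u); apply => w wI.
by apply: (subvP _ _ (Uus w wI)); apply/limgS/subvf.
Qed.

Section Generation.
Variables (m : nat) (ver : 'I_m -> V) (X : 'M[F]_(m, d)).
Hypothesis gen_local : forall u, {in U u, forall y, exists c : 'rV[F]_m,
  y - \sum_(j | ver j == u) c 0 j *: row j X \in radv u}.

(** A form of Nakayama's lemma. Only images at [b] are tracked: a radical vector coming from [a']
    either dies at [b] or leads back to a vertex with smaller [after], so the induction ends. *)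
Lemma generation b : {in U b, forall y, (y <= genframe ver X b)%MS}.
Proof.
suff H n a : (after f a b < n)%N -> {in U a, forall y, (f a b y <= genframe ver X b)%MS}.
  by move=> y yb; rewrite -(fid Hf b y); apply: (H _ _ (ltnSn _)).
elim: n a => // n IHn a; rewrite ltnS => an y ya.
have [c] := gen_local ya; rewrite /radv => /memv_sumP[z zU].
move/(canRL (subrK _)) ->; rewrite linearD linear_sum /= addmx_sub //; last first.
  rewrite linear_sum; apply: summx_sub => j /eqP <-.
  by rewrite linearZ /= scalemx_sub // -(row_genframe ver X b j) row_sub.
apply: summx_sub => a' aa; have /memv_imgP[t tU ->] := zU a' aa.
have [h|nh] := boolP (geo a' a b); last by rewrite (ngeoE Hf _ nh) sub0mx.
by rewrite (geoE _ h); apply: IHn => //; apply: leq_trans (after_lt Hf h aa) an.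
Qed.

Hypothesis row_in : forall j, row j X \in U (ver j).

Lemma genframe_in b j : row j (genframe ver X b) \in U b.
Proof. by rewrite row_genframe mem_f. Qed.

Lemma generation_spanned b : spanned_by (U b) (genframe ver X b).
Proof.
move=> y; apply/idP/idP => [|/submxP[D ->]]; first exact: generation.
rewrite mulmx_sum_row; apply: memv_suml => j _; apply: memvZ.
exact: genframe_in.
Qed.

Hypothesis ind_local : forall u (c : 'rV[F]_m),
  \sum_(j | ver j == u) c 0 j *: row j X \in radv u ->
  forall j, ver j = u -> c 0 j = 0.
Hypothesis tf : torsion_free f U.

(* A relation at [b] is refuted by a functional that is nonzero on the
   contribution of a vertex [s] closest to [b] and extends over all of [V]. *)
Lemma genframe_free b : row_free (genframe ver X b).
Proof.
rewrite -kermx_eq0; apply/eqP/row_matrixP => i; rewrite row0.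
set c := row i _; have c0 : c *m genframe ver X b = 0.
  by rewrite -row_mul mulmx_ker row0.
clearbody c; clear i; apply/eqP/negPn/negP => /eqP/rowP nc.
have [j0 cj0] : exists j, c 0 j != 0.
  apply/existsP; rewrite -negb_forall; apply/negP => /forallP h; apply: nc => j.
  by rewrite mxE; apply/eqP.
pose P u := [exists j, (ver j == u) && (c 0 j != 0)].
pose x u := \sum_(j | ver j == u) c 0 j *: row j X.
have xU u : x u \in U u.
  by apply: memv_suml => j /eqP <-; apply/memvZ/row_in.
have xr u : P u -> x u \notin radv u.
  case/existsP => j /andP[/eqP vj nz]; apply: contra nz => xr.
  by apply/eqP/(ind_local xr).
have x0 u : ~~ P u -> x u = 0.
  move=> /existsPn h; apply: big1 => j /eqP vj.
  by have := h j; rewrite vj eqxx /= negbK => /eqP->; rewrite scale0r.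
have Pj0 : P (ver j0) by apply/existsP; exists j0; rewrite eqxx.
case: (arg_maxnP (fun u => after f u b) Pj0) => s Ps smax.
have [phi0 [phi0x phi0r]] := functional_sep (xr s Ps).
(* Torsion-freeness allows [S] to be everything: each [U s :&: lker (f s e)] with [e != s] lies in
   the radical, where [phi0] vanishes. *)
have [|||phi [phis phiP]] :=
  extend_functional Hf HU (S := xpredT) (s := s) (phi0 := phi0).
- by [].
- by move=> a as_ y ya; apply/phi0r/mem_rad.
- move=> e _ y yk; have [es|es] := eqVneq e s.
    move: yk; rewrite es memv_cap memv_ker (fid Hf) => /andP[_ /eqP->].
    by rewrite linear0.
  by apply: phi0r; rewrite eq_sym in es; apply: (subvP (tf es)).
have : \sum_u f u b (x u) = 0.
  rewrite -[RHS]c0 mul_genframe (partition_big ver xpredT) //=.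
  apply: eq_bigr => u _; rewrite linear_sum; apply: eq_bigr => j /eqP <-.
  by rewrite linearZ.
move/(congr1 (phi b)); rewrite linear0 linear_sum (bigD1 s) //=.
rewrite phiP // (geo_sl Hf) phis phi0x big1 => [/eqP|u us].
  by rewrite addr0 oner_eq0.
rewrite phiP //; case: ifP => // sub_.
have [Pu|nPu] := boolP (P u); last by rewrite x0 ?linear0.
have /= := smax u Pu; rewrite leqNgt (after_lt Hf sub_) //.
by rewrite eq_sym.
Qed.

End Generation.

(** For each [u], a basis of a complement of [radv u] in [U u]; the last two clauses make it a basis
    modulo the radical. The dependent sum [T] collects these bases, and its enumeration numbers the
    rows of [X]. *)
Lemma local_generators : exists m (ver : 'I_m -> V) (X : 'M[F]_(m, d)),
  [/\ forall u, (#|[pred j | ver j == u]| + \dim (radv u) = \dim (U u))%N,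
      forall j, row j X \in U (ver j),
      forall u, {in U u, forall y, exists c : 'rV[F]_m,
        y - \sum_(j | ver j == u) c 0 j *: row j X \in radv u} &
      forall u (c : 'rV[F]_m),
        \sum_(j | ver j == u) c 0 j *: row j X \in radv u ->
        forall j, ver j = u -> c 0 j = 0].
Proof.
pose C u : {vspace 'rV[F]_d} := (U u :\: radv u)%VS.
pose T : finType := {u : V & 'I_(\dim (C u))}.
pose gen (t : T) : 'rV[F]_d := (vbasis (C (tag t)))`_(tagged t).
pose ver (j : 'I_#|{: T}|) : V := tag (enum_val j).
pose X : 'M[F]_(#|{: T}|, d) := \matrix_j gen (enum_val j).
have genC t : gen t \in C (tag t).
  by apply: vbasis_mem; rewrite mem_nth // size_tuple.
have sumE u (k : T -> F) :
    \sum_(j | ver j == u) k (enum_val j) *: row j X =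
    \sum_(i < \dim (C u)) k (Tagged _ i) *: (vbasis (C u))`_i.
  transitivity (\sum_(t : T | tag t == u) k t *: gen t).
    rewrite [RHS](reindex (@enum_val T predT)) /=; last first.
      exact/onW_bij/enum_val_bij.
    by apply: eq_bigr => j _; rewrite rowK.
  pose h v (i : 'I_(\dim (C v))) := k (Tagged _ i) *: (vbasis (C v))`_i.
  transitivity (\sum_(v | v == u) \sum_(i < \dim (C v)) h v i).
    rewrite sig_big_dep /=.
    by apply: eq_big => [t|[t1 t2] _]; rewrite ?andbT.
  by rewrite big_pred1_eq.
exists #|{: T}|, ver, X; split=> [u|j|u y yU|u c].
- rewrite -(dimv_cap_compl (U u) (radv u)) addnC (capv_idPr (radv_sub u)); congr addn.
  have -> : \dim (U u :\: radv u) = (\sum_(i < \dim (C u)) 1)%N.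
    by rewrite sum1_card card_ord.
  rewrite -sum1_card.
  transitivity (\sum_(v | v == u) \sum_(i < \dim (C v)) 1)%N; last first.
    by rewrite big_pred1_eq.
  rewrite sig_big_dep /= [RHS](reindex (@enum_val T predT)) /=; last first.
    exact/onW_bij/enum_val_bij.
  by apply: eq_bigl => j; rewrite andbT.
- by rewrite rowK; apply: (subvP (diffvSl _ _)); apply: genC.
- have : y \in (U u :&: radv u + C u)%VS by rewrite addvC addv_diff_cap.
  case/memv_addP => g; rewrite memv_cap => /andP[_ gr] [z zC ->].
  pose cz (t : T) : F := coord (vbasis (C (tag t))) (tagged t) z.
  exists (\row_j (if tag (enum_val j) == u then cz (enum_val j) else 0)).
  rewrite (eq_bigr (fun j => cz (enum_val j) *: row j X)).
    rewrite (sumE u cz) /= /cz /=.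
    by rewrite -coord_vbasis // addrK.
  by move=> j vj; rewrite mxE; move: vj; rewrite /ver => ->.
pose k (t : T) := c 0 (enum_rank t).
rewrite (eq_bigr (fun j => k (enum_val j) *: row j X)) => [|j _]; last first.
  by rewrite /k enum_valK.
rewrite sumE => h.
have : \sum_(i < \dim (C u)) k (Tagged _ i) *: (vbasis (C u))`_i \in (radv u :&: C u)%VS.
  rewrite memv_cap h; apply: memv_suml => i _; apply: memvZ; apply: vbasis_mem.
  by rewrite mem_nth // size_tuple.
have /freeP fr := basis_free (vbasisP (C u)).
rewrite capvC capv_diff memv0 => /eqP/fr k0 j vj.
have := k0; move: (enum_valK j) vj; rewrite /ver /k; case: (enum_val j) => u' i /= <- eu.
by subst u'; apply.
Qed.


End Subrep.
End Generators.

(** Upper bounds for [P] and for its complement suffice, because the two diagonal matrices add up to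
    the identity. *)
Lemma rank_diag_pred (F : fieldType) n (P : pred 'I_n) :
  \rank (diag_mx (\row_j (P j)%:R : 'rV[F]_n)) = #|P|.
Proof.
pose D (Q : pred 'I_n) : 'M[F]_n := diag_mx (\row_j (Q j)%:R).
have le (Q : pred 'I_n) : (\rank (D Q) <= #|Q|)%N.
  have -> : D Q = \sum_(j | Q j) delta_mx j j.
    rewrite big_mkcond; apply/matrixP => i k; rewrite summxE !mxE (bigD1 i) //= big1.
      by rewrite addr0; case: (Q i); rewrite !mxE ?eqxx /= ?mul0rn // eq_sym.
    by move=> j ji; case: ifP; rewrite !mxE // eq_sym (negPf ji).
  rewrite -sum1_card; apply: (big_ind2 (fun (A : 'M[F]_n) k => (\rank A <= k)%N)).
  - by rewrite mxrank0.
  - by move=> A a B b hA hB; apply: leq_trans (mxrank_add _ _) (leq_add hA hB).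
  by move=> j _; rewrite mxrank_delta.
apply/eqP; rewrite eqn_leq le /= -(leq_add2r #|predC P|).
rewrite cardC card_ord; apply: leq_trans (leq_add (leqnn _) (le (predC P))).
apply: leq_trans (mxrank_add _ _).
have -> : D P + D (predC P) = 1%:M; last by rewrite mxrank1.
apply/matrixP => i j; rewrite !mxE -mulrnDl; congr (_ *+ _).
by rewrite /=; case: (P i); rewrite ?addr0 ?add0r.
Qed.

(** * Subrepresentations freely generated by [r] vectors *)

Section Presented.
Variables (F : fieldType) (V : finType) (d r : nat).
Variables (f : V -> V -> 'End('rV[F]_d)) (I : V -> {set V}).
Hypothesis Hf : lwi_maps f I.
Variable v0 : V.
Implicit Types U W : V -> {vspace 'rV[F]_d}.

Local Notation geo := (geo f).

Definition linked U :=
  (forall v, \dim (U v) = r) /\ (forall a b, (f a b @: U a <= U b)%VS).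

(** When all [U b] have dimension [r], the [r] rows form a basis at every vertex: [U] is a direct
    sum of projectives, and [ver] records its isomorphism type. *)
Definition presented (ver : 'I_r -> V) U :=
  exists X : 'M[F]_(r, d), forall b, spanned_by (U b) (genframe f ver X b).

Definition rk U a b := \dim (f a b @: U a).

Definition fiber_card (ver : 'I_r -> V) u := #|[pred j | ver j == u]|.

Lemma fiber_card_sum ver : (\sum_u fiber_card ver u = r)%N.
Proof.
rewrite -[RHS]card_ord -sum1_card (partition_big ver xpredT) //=.
by apply: eq_bigr => u _; rewrite sum1_card.
Qed.

Lemma torsion_free_presented U : linked U -> torsion_free f U ->
  exists ver, presented ver U.
Proof.
move=> [dU HU] tf; have [m [ver [X [_ rin gen ind]]]] := local_generators HU.
have sp := generation_spanned Hf HU gen rin.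
have fr := genframe_free Hf HU rin ind tf.
have mr : m = r by rewrite -(dU v0) (dim_spanned (sp v0)); apply/esym/eqP/fr.
by subst m; exists ver, X.
Qed.

(** The hypothesis bounds the number of generators by [r]; since they span [U v0], there are exactly
    [r], and they are independent at every vertex. *)
Lemma count_presented U : linked U ->
  (\sum_u (r - \dim (radv f U u)) <= r)%N ->
  exists ver, presented ver U /\
    forall u, fiber_card ver u = (r - \dim (radv f U u))%N.
Proof.
move=> lU le; have [dU HU] := lU.
have [m [ver [X [card_ver rin gen ind]]]] := local_generators HU.
have sp := generation_spanned Hf HU gen rin.
have mle : (m <= r)%N.
  rewrite -[m]card_ord -sum1_card (partition_big ver xpredT) //=.
  apply: leq_trans le; apply: leq_sum => u _.
  by rewrite sum1_card -(dU u) -(card_ver u) addnK.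
have mr : m = r.
  by apply/eqP; rewrite eqn_leq mle -(dU v0) (dim_spanned (sp v0)) rank_leq_row.
subst m; exists ver; split; first by exists X.
by move=> u; rewrite -(dU u) -(card_ver u) addnK.
Qed.

Section OnePresentation.
Variables (U : V -> {vspace 'rV[F]_d}) (ver : 'I_r -> V) (X : 'M[F]_(r, d)).
Hypothesis dU : forall v, \dim (U v) = r.
Hypothesis UX : forall b, spanned_by (U b) (genframe f ver X b).

Lemma presentation_free b : row_free (genframe f ver X b).
Proof. by rewrite /row_free -(dim_spanned (UX b)) dU. Qed.

Lemma presentation_img a b : genframe f ver X a *m lin1_mx (f a b) =
  diag_mx (\row_j (geo (ver j) a b)%:R) *m genframe f ver X b.
Proof.
apply/row_matrixP => j; rewrite row_mul mul_rV_lin1 /= (f_row_genframe Hf) row_mul.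
rewrite row_diag_mx mxE -scalemxAl -rowE.
by case: ifP; rewrite ?scale1r ?scale0r.
Qed.

Lemma presentation_rk a b : rk U a b = #|[pred j | geo (ver j) a b]|.
Proof.
rewrite /rk (dim_spanned (spanned_img (f a b) (UX a))) presentation_img.
by rewrite mxrankMfree ?presentation_free // rank_diag_pred.
Qed.

End OnePresentation.

Lemma presented_rk ver U a b : (forall v, \dim (U v) = r) -> presented ver U ->
  rk U a b = #|[pred j | geo (ver j) a b]|.
Proof. by move=> dU [X UX]; apply: presentation_rk dU UX _ _. Qed.

(** A generator not placed at [u] is counted once, in the unique branch through which it reaches
    [u]. *)
Lemma presented_branches ver u :
  (\sum_(w in I u) #|[pred j | geo (ver j) w u]| = r - fiber_card ver u)%N.
Proof.
rewrite /fiber_card -[X in (X - _)%N](card_ord r) -(cardC [pred j | ver j == u]).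
rewrite addKn -sum1_card.
transitivity (\sum_(w in I u) \sum_(j | (ver j != u) && geo (ver j) w u) 1)%N.
  apply: eq_bigr => w wI; rewrite -sum1_card; apply: eq_bigl => j.
  rewrite inE /=; case: eqP => //= ->; apply/negP => /(lwi_loop Hf) uw.
  by subst w; have := lwi_notin Hf u; rewrite wI.
rewrite (exchange_big_dep [pred j | ver j != u]) /=; last by move=> w j _ /andP[].
apply: eq_bigr => j vju; have [w wI jw] := lwi_branch Hf vju.
rewrite (bigD1 w) /=; last by rewrite wI vju.
rewrite big1 // => w' /andP[/andP[w'I /andP[_ jw']]].
by rewrite (branch_uniq Hf w'I wI jw' jw) eqxx.
Qed.

(** Larger ranks give larger radicals, hence at most as many generators of [W] as of [U] at each
    vertex. Both totals equal [r], so the numbers agree everywhere. *)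
Lemma presented_le ver U W : linked U -> presented ver U -> linked W ->
  (forall a b, (rk U a b <= rk W a b)%N) ->
  exists ver', presented ver' W /\ fiber_card ver' =1 fiber_card ver.
Proof.
move=> lU pU lW le; have [dU HU] := lU; have [dW HW] := lW.
have fibE u : fiber_card ver u = (r - \dim (radv f U u))%N.
  rewrite (dim_radv Hf HU) (eq_bigr _ (fun w _ => presented_rk w u dU pU)).
  rewrite presented_branches subKn // /fiber_card.
  by apply: leq_trans (max_card _) _; rewrite card_ord.
have le_fib u : (r - \dim (radv f W u) <= fiber_card ver u)%N.
  rewrite fibE leq_sub2l // (dim_radv Hf HU) (dim_radv Hf HW).
  by apply: leq_sum => w _; apply: le.
have [|ver' [pW fib']] := count_presented lW.
  by rewrite -[X in (_ <= X)%N](fiber_card_sum ver); apply: leq_sum => u _.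
exists ver'; split=> // u; apply/eqP; move: u.
have: (\sum_u fiber_card ver' u = \sum_u fiber_card ver u)%N.
  by rewrite !fiber_card_sum.
have leif u : (fiber_card ver' u <= fiber_card ver u
    ?= iff (fiber_card ver' u == fiber_card ver u))%N.
  by split=> //; rewrite fib'.
move/eqP; rewrite (leqif_sum (fun u _ => leif u)).
by move/forall_inP => h u; apply: h.
Qed.

Lemma presented_perm ver ver' U : fiber_card ver' =1 fiber_card ver ->
  presented ver' U -> presented ver U.
Proof.
move=> fE [X UX]; have : perm_eq [tuple ver i | i < r] [tuple ver' i | i < r].
  apply/allP => u _ /=; apply/eqP.
  have cE (w : 'I_r -> V) : count_mem u [tuple w i | i < r] = fiber_card w u.
    by rewrite /= count_map /fiber_card cardE size_filter enumT.
  by rewrite !cE fE.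
move/tuple_permP => [s sE].
have vE i : ver i = ver' (s i).
  have := congr1 (fun t => nth v0 t i) sE.
  by rewrite -!tnth_nth !tnth_mktuple.
have row_rp (A : 'M[F]_(r, d)) i : row i (row_perm s A) = row (s i) A.
  by apply/rowP => j; rewrite !mxE.
exists (row_perm s X) => b x.
have -> : genframe f ver (row_perm s X) b = row_perm s (genframe f ver' X b).
  by apply/row_matrixP => i; rewrite row_genframe vE row_rp row_rp row_genframe.
by rewrite UX row_permE (eqmxMfull _ _) // row_full_unit unitmx_perm.
Qed.

End Presented.

(** * Zariski topology *)

Section PolynomialFunctions.
Variable F : fieldType.
Implicit Types g h : F -> F.

Definition polyfun g := exists p : {poly F}, forall t, g t = p.[t].

Lemma polyfun_cst c : polyfun (fun=> c).
Proof. by exists c%:P => t; rewrite hornerC. Qed.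

Lemma polyfun_id : polyfun id.
Proof. by exists 'X => t; rewrite hornerX. Qed.

Lemma polyfunD g h : polyfun g -> polyfun h -> polyfun (fun t => g t + h t).
Proof. by move=> [p gp] [q hq]; exists (p + q) => t; rewrite hornerD gp hq. Qed.

Lemma polyfunM g h : polyfun g -> polyfun h -> polyfun (fun t => g t * h t).
Proof. by move=> [p gp] [q hq]; exists (p * q) => t; rewrite hornerM gp hq. Qed.

Lemma polyfun_sum (J : Type) (s : seq J) (P : pred J) (g : J -> F -> F) :
  (forall j, polyfun (g j)) -> polyfun (fun t => \sum_(j <- s | P j) g j t).
Proof.
move=> pg; have [p gp] := choice pg; exists (\sum_(j <- s | P j) p j) => t.
by rewrite horner_sum; apply: eq_bigr => j _; apply: gp.
Qed.

Lemma polyfun_prod (J : Type) (s : seq J) (P : pred J) (g : J -> F -> F) :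
  (forall j, polyfun (g j)) -> polyfun (fun t => \prod_(j <- s | P j) g j t).
Proof.
move=> pg; have [p gp] := choice pg; exists (\prod_(j <- s | P j) p j) => t.
by rewrite horner_prod; apply: eq_bigr => j _; apply: gp.
Qed.

Lemma polyfunX g n : polyfun g -> polyfun (fun t => g t ^+ n).
Proof. by move=> [p gp]; exists (p ^+ n) => t; rewrite horner_exp gp. Qed.

Definition polymx m n (A : F -> 'M[F]_(m, n)) :=
  forall i j, polyfun (fun t => A t i j).

Lemma polyfun_ext g h : g =1 h -> polyfun g -> polyfun h.
Proof. by move=> /funext->. Qed.

Lemma polymx_mull m n k (B : 'M[F]_(k, m)) (A : F -> 'M[F]_(m, n)) :
  polymx A -> polymx (fun t => B *m A t).
Proof.
move=> pA i j; apply: (@polyfun_ext (fun t => \sum_l B i l * A t l j)).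
  by move=> t; rewrite mxE.
by apply: polyfun_sum => l; apply: polyfunM => //; apply: polyfun_cst.
Qed.

Lemma polymx_mulr m n k (B : 'M[F]_(n, k)) (A : F -> 'M[F]_(m, n)) :
  polymx A -> polymx (fun t => A t *m B).
Proof.
move=> pA i j; apply: (@polyfun_ext (fun t => \sum_l A t i l * B l j)).
  by move=> t; rewrite mxE.
by apply: polyfun_sum => l; apply: polyfunM => //; apply: polyfun_cst.
Qed.

Lemma polyfun_det n (A : F -> 'M[F]_n) : polymx A -> polyfun (fun t => \det (A t)).
Proof.
move=> pA; apply: polyfun_sum => s; apply: polyfunM; first exact: polyfun_cst.
by apply: polyfun_prod => i; apply: pA.
Qed.

(** Stated with one polynomial, so that a conjunction corresponds to a product. *)
Definition generic (Q : F -> Prop) := exists p : {poly F},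
  p != 0 /\ forall t, p.[t] != 0 -> Q t.

Lemma generic_neq0 g t0 : polyfun g -> g t0 != 0 -> generic (fun t => g t != 0).
Proof.
move=> [p gp] nz; exists p; split=> [|t]; last by rewrite gp.
by apply: contraNneq nz => p0; rewrite gp p0 horner0.
Qed.

Lemma generic_and Q Q' : generic Q -> generic Q' -> generic (fun t => Q t /\ Q' t).
Proof.
move=> [p [p0 pQ]] [q [q0 qQ]]; exists (p * q); split; first exact: mulf_neq0.
by move=> t; rewrite hornerM mulf_eq0 negb_or => /andP[/pQ ? /qQ].
Qed.

Lemma generic_forall (J : finType) (Q : J -> F -> Prop) :
  (forall j, generic (Q j)) -> generic (fun t => forall j, Q j t).
Proof.
move=> /choice[p pP]; exists (\prod_j p j); split.
  by apply/prodf_neq0 => j _; case: (pP j).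
move=> t; rewrite horner_prod => /prodf_neq0 nz j.
by apply: (proj2 (pP j)); apply: nz.
Qed.

Lemma generic_imply (Q Q' : F -> Prop) : (forall t, Q t -> Q' t) -> generic Q ->
  generic Q'.
Proof. by move=> QQ' [p [p0 pQ]]; exists p; split=> // t /pQ/QQ'. Qed.

(** With one-sided inverses [P] and [Q] of the factors of [A t0], the polynomial
    [\det (P *m A t *m Q)] equals 1 at [t0], and its nonvanishing bounds the rank from below. *)
Lemma generic_rank m n (A : F -> 'M[F]_(m, n)) t0 : polymx A ->
  generic (fun t => (\rank (A t0) <= \rank (A t))%N).
Proof.
move=> pA; have [P PE] := row_fullP (col_base_full (A t0)).
have [Q QE] := row_freeP (row_base_free (A t0)).
have pdet : polyfun (fun t => \det (P *m A t *m Q)).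
  by apply/polyfun_det/polymx_mulr/polymx_mull.
apply: generic_imply (@generic_neq0 _ t0 pdet _) => [t|].
  rewrite -unitfE -[_ \is a _]/(_ \in unitmx) -row_full_unit => /eqP rkE.
  rewrite -[X in (X <= _)%N]rkE.
  by apply: leq_trans (mxrankM_maxl _ _) (mxrankM_maxr _ _).
rewrite (_ : P *m A t0 *m Q = 1%:M) ?det1 ?oner_neq0 //.
transitivity (P *m (col_base (A t0) *m row_base (A t0)) *m Q).
  by rewrite mulmx_base.
by rewrite -mulmxA -[_ *m row_base _ *m Q]mulmxA QE mulmx1.
Qed.

End PolynomialFunctions.

Lemma generic_exists (F : closedFieldType) (Q : F -> Prop) :
  generic Q -> exists t, Q t.
Proof.
move=> [p [nzp pQ]]; have [t nrt] := closed_nonrootP p nzp; exists t.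
by apply: pQ; rewrite -rootE.
Qed.

Section Zariski.
Variables (F : fieldType) (V : finType) (d r : nat).
Local Notation X := (grprod F V d r).

Lemma frame_realize (A : V -> 'M[F]_(r, d)) :
  (forall v, row_free (A v)) -> exists U : X, frame U A.
Proof.
move=> fA; pose W v : {vspace 'rV[F]_d} := <<[tuple row i (A v) | i < r]>>%VS.
have WA v : spanned_by (W v) (A v) := spanned_rows (A v).
have dW v : \dim (W v) == r by rewrite (dim_spanned (WA v)); exact: fA.
exists [ffun v => exist _ (W v) (dW v)] => v y.
by rewrite /gsub ffunE; apply: WA.
Qed.

Lemma frame_free (U : X) A v : frame U A -> row_free (A v).
Proof.
move=> fA; have /eqP dU : \dim (gsub U v) == r by exact: (valP (U v)).
by rewrite /row_free -(dim_spanned (fA v)) dU.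
Qed.

Lemma dim_gsub (U : X) v : \dim (gsub U v) = r.
Proof. exact/eqP/(valP (U v)). Qed.

Lemma polyfun_plucker (A : F -> V -> 'M[F]_(r, d)) (P : plucker_poly F V d r) :
  (forall v, polymx (fun t => A t v)) ->
  polyfun (fun t => mpoly.meval (plucker (A t)) P).
Proof.
move=> pA; apply: (@polyfun_ext _ (fun t => \sum_(m <- mpoly.msupp P)
    mpoly.mcoeff m P * \prod_i plucker (A t) i ^+ m i)).
  by move=> t; rewrite mpoly.mevalE.
apply: polyfun_sum => m; apply: polyfunM; first exact: polyfun_cst.
apply: polyfun_prod => i; apply: polyfunX; apply: polyfun_det => a b.
by apply: polyfun_ext (pA (enum_val i).1 a ((enum_val i).2 b)) => t; rewrite mxE.
Qed.

(** Non-vanishing is witnessed in some frame of [U]; rescaling the polynomial moves the witness to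
    the given frame [A]. *)
Lemma not_vanishes_frame (U : X) A P : frame U A -> ~ vanishes P U ->
  exists P', mpoly.meval (plucker A) P' != 0 /\
    forall (W : X) C, frame W C -> mpoly.meval (plucker C) P' != 0 ->
      ~ vanishes P W.
Proof.
move=> fA /existsNP[B /not_implyP[fB nz]].
have [G Gu BE] := frame_unique fA fB.
exists (rescale G P); split.
  rewrite rescaleE; apply/eqP; rewrite (_ : (fun v => _) = B) //.
  by apply/funext => v; rewrite BE.
move=> W C fC; rewrite rescaleE => /eqP nzC vW; apply: nzC.
exact: vW (frame_mul Gu fC).
Qed.

Variable Z : set X.
Local Notation T := (set_type Z).

Lemma open_nvanish (S : set (plucker_poly F V d r)) :
  open [set W : T | exists2 P, S P & ~ vanishes P (set_val W)].
Proof.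
exists (~` zlocus S); first by exists S.
apply/seteqP; split=> W /=.
  by move=> /existsNP[P /not_implyP[SP nv]]; exists P.
by case=> P SP nv h; apply/nv/h.
Qed.

Lemma open_plucker (O : set T) (U : T) A : open O -> O U ->
  frame (set_val U) A ->
  exists P, mpoly.meval (plucker A) P != 0 /\
    forall (W : T) C, frame (set_val W) C ->
      mpoly.meval (plucker C) P != 0 -> O W.
Proof.
move=> [O' [S ->] OE] OU fA.
have nv (W : T) : O W <-> ~ zlocus S (set_val W) by rewrite -OE.
have /nv/existsNP[P /not_implyP[SP vP]] := OU.
have [P' [nz h]] := not_vanishes_frame fA vP.
exists P'; split=> // W C fC nzC; apply/nv => /(_ P SP); exact: h fC nzC.
Qed.

(* The linear form in the Pluecker coordinates of the factor [a] whose value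
   is [\det (A a *m Y)]. *)
Definition det_form (a : V) (Y : 'M[F]_(d, r)) : plucker_poly F V d r :=
  \sum_(g : {ffun 'I_r -> 'I_d}) (\prod_j Y (g j) j) *:
     mpoly.mpolyX F (mpoly.mnm1 (enum_rank (a, g))).

(** Because the coordinates are indexed by all maps [g], not just increasing ones, this is the
    distributive law applied to the expansion of the determinant. *)
Lemma det_formE a Y (A : V -> 'M[F]_(r, d)) :
  mpoly.meval (plucker A) (det_form a Y) = \det (A a *m Y).
Proof.
rewrite /det_form raddf_sum /= -[RHS]det_tr /determinant.
transitivity (\sum_(s : 'S_r) \sum_(g : {ffun 'I_r -> 'I_d})
    (-1) ^+ s * \prod_j (A a (s j) (g j) * Y (g j) j)).
  rewrite exchange_big /=; apply: eq_bigr => g _.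
  rewrite mpoly.mevalZ mpoly.mevalXU /plucker enum_rankK /= -det_tr mulr_sumr.
  apply: eq_bigr => s _; rewrite mulrCA; congr (_ * _).
  by rewrite mulrC -big_split /=; apply: eq_bigr => j _; rewrite !mxE.
apply: eq_bigr => s _; rewrite -mulr_sumr; congr (_ * _).
rewrite -(bigA_distr_bigA (fun j k => A a (s j) k * Y k j)).
by apply: eq_bigr => j _; rewrite !mxE.
Qed.

(** Pluecker coordinates are minors of full size [r], so a nonzero minor of size [k] of [A a *m G]
    has to be completed: the first [k] columns of [Y] lie in the column space of [G], the others are
    free. *)
Lemma open_rank (a : V) (g : 'End('rV[F]_d)) k :
  open [set W : T | (k <= \dim (g @: gsub (set_val W) a))%N].
Proof.
have [kr|rk] := leqP k r; last first.
  rewrite (_ : [set W : T | _] = set0); first exact: open0.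
  apply/seteqP; split=> // W /= kd; have := leq_trans rk kd.
  have := limg_ker_dim g (gsub (set_val W) a); rewrite dim_gsub => dE.
  by rewrite ltnNge; apply/negP/negPn; rewrite -[X in (_ <= X)%N]dE leq_addl.
pose G := lin1_mx g.
pose S := [set P : plucker_poly F V d r | exists Y Y' : 'M[F]_(d, r),
  Y *m pid_mx k = G *m Y' /\ P = det_form a Y].
rewrite (_ : [set W : T | _] =
    [set W : T | exists2 P, S P & ~ vanishes P (set_val W)]).
  exact: open_nvanish.
apply/seteqP; split=> W /=.
  have [A fA] := frame_exists (set_val W).
  have [B AB] := row_freeP (frame_free a fA).
  rewrite (dim_spanned (spanned_img g (fA a))) -/G => kd.
  pose AG := A a *m G; pose L := col_ebase AG.
  have AGE : L *m pid_mx (\rank AG) *m row_ebase AG = AG := mulmx_ebase AG.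
  pose Y0 : 'M[F]_(d, r) := invmx (row_ebase AG) *m pid_mx k.
  have AGY : AG *m Y0 = L *m pid_mx k.
    rewrite -[in LHS]AGE /Y0 -!mulmxA mulKVmx ?row_ebase_unit // mul_pid_mx.
    by rewrite (minn_idPr kd) (minn_idPr (leq_trans kd (rank_leq_col _))).
  clearbody Y0; pose pk : 'M[F]_r := pid_mx k.
  (* This choice makes [A a *m Y] equal to the invertible [L]: the first summand yields the first
     [k] columns, and the right inverse [B] of [A a] supplies the rest. *)
  exists (det_form a (G *m (Y0 *m pk) + B *m (L *m copid_mx k))).
    exists (G *m (Y0 *m pk) + B *m (L *m copid_mx k)), (Y0 *m pk *m pk).
    by rewrite mulmxDl -!mulmxA mul_copid_mx_pid // !mulmx0 addr0.
  move=> /(_ A fA)/eqP; rewrite det_formE mulmxDr !mulmxA -/AG AGY AB mul1mx.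
  rewrite -mulmxA /pk pid_mx_id // -mulmxDr addrC subrK mulmx1.
  by apply/negP; rewrite -unitfE -[_ \is a _]/(L \in unitmx) col_ebase_unit.
case=> _ [Y [Y' [YE ->]]] /existsNP[A /not_implyP[fA]].
rewrite det_formE => /eqP nz.
rewrite (dim_spanned (spanned_img g (fA a))) -/G.
have uAY : A a *m Y \in unitmx by rewrite unitmxE unitfE.
have <- : \rank (A a *m Y *m (pid_mx k : 'M_r)) = k.
  by rewrite eqmxMfull ?row_full_unit // rank_pid_mx.
by rewrite -mulmxA YE mulmxA mxrankM_maxl.
Qed.

End Zariski.

(** * Lattice configurations *)

Lemma divf_decomp (K : fieldType) (a b e g : K) : g != 0 -> b != 0 ->
  a * e = a * b^-1 * (e / g) * (b * g).
Proof. by move=> nzg nzb; rewrite mulrACA !divfK. Qed.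

(** The upper bounds, coming from four inclusions, add up to the totals that the two triangle
    inequalities bound from below, so all are equalities. *)
Lemma segment_lengths (n m k nzu nvz nuz nzv : int) :
  nzu <= k -> nvz <= m - k -> nuz <= 1 - k -> nzv <= n - 1 + k ->
  m <= nvz + nzu -> n <= nuz + nzv ->
  [/\ nzu = k, nvz = m - k, nuz = 1 - k & nzv = n - 1 + k].
Proof. by move=> *; split; lia. Qed.

Section Lattices.
Import Order.TTheory Num.Theory.
Variables (R : idomainType) (pi : R) (F : fieldType) (res : {rmorphism R -> F}).
Hypotheses (R_dvr : is_dvr R) (pi_unif : is_uniformizer pi)
  (res_residue : is_residue_map res).

Local Notation K := {fraction R}.
Local Notation tf := (@FracField.tofrac R).
Local Notation piK := (tf pi).

Lemma nonunit_pi x : nonunits x <-> exists y, x = pi * y.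
Proof.
by rewrite pi_unif; split=> [[y _ <-]|[y ->]]; exists y.
Qed.

Lemma pi_neq0 : pi != 0.
Proof.
have [_ _ [x nzx /nonunit_pi[y xE]]] := R_dvr.
by apply: contraNneq nzx => pi0; rewrite xE pi0 mul0r.
Qed.

Lemma pi_nonunit y : pi * y != 1.
Proof.
have : nonunits pi by apply/nonunit_pi; exists 1; rewrite mulr1.
by rewrite /nonunits /=; apply: contraNneq => piy; apply/unitrPr; exists y.
Qed.

Lemma res_pi : res pi = 0.
Proof. by apply/(proj2 res_residue)/nonunit_pi; exists 1; rewrite mulr1. Qed.

Lemma res_eq0 x : res x = 0 <-> exists y, x = pi * y.
Proof. by rewrite (proj2 res_residue) nonunit_pi. Qed.

Lemma dvr_decomp a : a != 0 -> exists n e, e \is a GRing.unit /\ a = pi ^+ n * e.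
Proof.
move=> nza; apply: contrapT => H.
have div n : exists b, a = pi ^+ n * b.
  elim: n => [|n [b aE]]; first by exists a; rewrite expr0 mul1r.
  have [ub|nub] := boolP (b \is a GRing.unit); first by case: H; exists n, b.
  have [b' bE] : exists y, b = pi * y by apply/nonunit_pi.
  by exists b'; rewrite aE bE mulrA -exprSr.
(* [J] is the saturation of the ideal of [a] with respect to [pi]. If [g] generates it with
   [pi ^+ n * g = a * y], then writing [a = pi ^+ n.+1 * b] with [b = g * z] gives
   [a = a * (pi * (y * z))], which would make [pi] a unit. *)
pose J : set R := [set x | exists n y, pi ^+ n * x = a * y].
have [|g gE] := (let: And3 h _ _ := R_dvr in h) J.
  split=> [|x y [n [p xE]] [m [q yE]]|c x [n [p xE]]].
  - by exists 0%N, 0; rewrite !mulr0.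
  - exists (n + m)%N, (pi ^+ m * p + pi ^+ n * q).
    transitivity (pi ^+ m * (pi ^+ n * x) + pi ^+ n * (pi ^+ m * y)).
      by rewrite exprD; ring.
    by rewrite xE yE; ring.
  by exists n, (c * p); rewrite mulrCA xE mulrCA.
have [n [y gy]] : J g by rewrite gE; exists 1; rewrite // mulr1.
have [b aE] := div n.+1.
have [z _ bE] : range (fun x => g * x) b.
  by rewrite -gE; exists n.+1, 1; rewrite mulr1 -aE.
have : a * (pi * (y * z)) = a * 1.
  rewrite mulr1 {2}aE -bE exprS (_ : pi * _ * _ = pi * (pi ^+ n * g) * z); last by ring.
  by rewrite gy; ring.
by move/(mulfI nza)/eqP; apply/negP/pi_nonunit.
Qed.

Lemma frac_decomp (x : K) : exists p q, q != 0 /\ x * tf q = tf p.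
Proof.
elim/quotW: x => y; exists (frac y).1, (frac y).2; split; first exact: denom_ratioP.
unlock FracField.tofrac; rewrite -[LHS]FracField.pi_mul; apply/eqmodP => /=.
by rewrite FracField.equivfE /FracField.mulf !numden_Ratio ?mulr1 ?mul1r ?oner_neq0
  ?denom_ratioP //; rewrite mulrC.
Qed.

Lemma tf_neq0 a : (tf a != 0) = (a != 0).
Proof. by rewrite tofrac_eq0. Qed.

Lemma piK_neq0 : piK != 0.
Proof. by rewrite tf_neq0 pi_neq0. Qed.

Lemma field_decomp (x : K) : x != 0 ->
  exists (k : int) e, e \is a GRing.unit /\ x = piK ^ k * tf e.
Proof.
have [p [q [nzq xE]]] := frac_decomp x => nzx.
have nzp : p != 0 by rewrite -tf_neq0 -xE mulf_neq0 // tf_neq0.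
have [n [e [ue pE]]] := dvr_decomp nzp; have [m [g [ug qE]]] := dvr_decomp nzq.
exists (n%:Z - m%:Z), (e * g^-1); split; first by rewrite unitrM ue unitrV.
have nzg : tf g != 0 by rewrite tf_neq0; apply: contraTneq ug => ->; rewrite unitr0.
apply: (@mulIf _ (tf q)); first by rewrite tf_neq0.
rewrite xE pE qE expfzDr ?piK_neq0 // -exprnN -exprnP !rmorphM rmorphV // !rmorphXn /=.
exact: (divf_decomp _ _ nzg (expf_neq0 _ piK_neq0)).
Qed.

Definition integral (x : K) := exists a, x = tf a.

Lemma integral_pi k : integral (piK ^ k) <-> 0 <= k.
Proof.
split=> [[a]|]; last by case: k => // n _; exists (pi ^+ n); rewrite rmorphXn.
case: k => // n; rewrite NegzE -exprnN => aE; have : tf (pi ^+ n.+1 * a) = tf 1.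
  by rewrite rmorphM rmorphXn /= -aE rmorph1 mulfV // expf_neq0 // piK_neq0.
move/eqP; rewrite tofrac_eq exprS -mulrA => /eqP h.
by have := pi_nonunit (pi ^+ n * a); rewrite h eqxx.
Qed.

Lemma integralM x y : integral x -> integral y -> integral (x * y).
Proof. by move=> [a ->] [b ->]; exists (a * b); rewrite rmorphM. Qed.

Lemma integral_piD k l x : integral (piK ^ k * x) -> k <= l -> integral (piK ^ l * x).
Proof.
move=> ix kl; rewrite -(subrK k l) expfzDr ?piK_neq0 // -mulrA.
by apply: integralM => //; apply/integral_pi; rewrite subr_ge0.
Qed.

Lemma integral_bound x : exists n : nat, integral (piK ^ n * x).
Proof.
have [->|nzx] := eqVneq x 0; first by exists 0%N, 0; rewrite mulr0 rmorph0.
have [k [e [_ ->]]] := field_decomp nzx; exists `|k|%N.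
rewrite mulrA -expfzDr ?piK_neq0 //; apply: integralM; last by exists e.
by apply/integral_pi; rewrite -lerBlDr sub0r abszE -normrN ler_norm.
Qed.

Lemma integral_lower x : x != 0 -> exists k : int,
  forall l, integral (piK ^ l * x) -> k <= l.
Proof.
move=> nzx; have [k [e [ue xE]]] := field_decomp nzx; exists (- k) => l il.
rewrite lerNl -subr_ge0 opprK addrC; apply/integral_pi.
have nze : tf e != 0 by rewrite tf_neq0; apply: contraTneq ue => ->; rewrite unitr0.
have -> : piK ^ (l + k) = (piK ^ l * x) * tf e^-1.
  by rewrite xE rmorphV // expfzDr ?piK_neq0 // -!mulrA mulfV // mulr1.
by apply: integralM => //; exists e^-1.
Qed.

Definition intmx m n (M : 'M[K]_(m, n)) := exists M' : 'M[R]_(m, n), M = map_mx tf M'.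

Lemma intmxP m n (M : 'M[K]_(m, n)) : intmx M <-> forall i j, integral (M i j).
Proof.
split=> [[M' ->] i j|h]; first by exists (M' i j); rewrite mxE.
have [a aE] : exists a : 'I_m -> 'I_n -> R, forall i j, M i j = tf (a i j).
  have [a aP] := choice (fun ij : 'I_m * 'I_n => h ij.1 ij.2).
  by exists (fun i j => a (i, j)) => i j; apply: (aP (i, j)).
by exists (\matrix_(i, j) a i j); apply/matrixP => i j; rewrite !mxE.
Qed.

Lemma map_tf_inj m n : injective (map_mx tf : 'M[R]_(m, n) -> 'M[K]_(m, n)).
Proof.
move=> A A' /matrixP h; apply/matrixP => i j; have := h i j; rewrite !mxE => /eqP.
by rewrite tofrac_eq => /eqP.
Qed.

Lemma intmx_piD m n k l (M : 'M[K]_(m, n)) :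
  intmx (piK ^ k *: M) -> k <= l -> intmx (piK ^ l *: M).
Proof.
move=> /intmxP h kl; apply/intmxP => i j; rewrite mxE.
by apply: integral_piD kl; have := h i j; rewrite mxE.
Qed.

Lemma redK_tf a : redK res (tf a) = res a.
Proof.
rewrite /redK; congr (res _).
have /(@xgetPex _ 0) : exists b, [set b | tf b = tf a] b by exists a.
by move=> /eqP; rewrite tofrac_eq => /eqP.
Qed.

Lemma map_redK m n (M : 'M[R]_(m, n)) : map_mx (redK res) (map_mx tf M) = map_mx res M.
Proof. by apply/matrixP => i j; rewrite !mxE redK_tf. Qed.

Lemma res_lift n (x : 'rV[F]_n) : exists c : 'rV[R]_n, x = map_mx res c.
Proof.
have h y : exists a, res a = y.
  by have [a _ <-] : range res y; [rewrite (proj1 res_residue) | exists a].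
have [a aE] := choice h.
by exists (map_mx a x); apply/rowP => i; rewrite !mxE aE.
Qed.

Lemma map_res_eq0 m n (M : 'M[R]_(m, n)) : map_mx res M = 0 -> exists M', M = pi *: M'.
Proof.
move=> /matrixP h.
have h' ij : exists y, M ij.1 ij.2 = pi * y.
  by apply/res_eq0; have := h ij.1 ij.2; rewrite !mxE.
have [a aE] := choice h'.
by exists (\matrix_(i, j) a (i, j)); apply/matrixP => i j; rewrite !mxE -aE.
Qed.

(** * Lengths and reduced maps of a lattice configuration *)

Section Configuration.
Variables (V : finType) (d : nat) (B : V -> 'M[K]_d).
Hypothesis d_gt0 : (0 < d)%N.
Hypothesis B_unit : forall v, B v \in unitmx.

Local Notation L v := (lat (B v)).
Local Notation inc := (pi_incl pi B).
Local Notation n_ := (nmin pi B).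
Local Notation fb := (fbar pi res B).
Local Notation T u v := (B u *m invmx (B v)).

Lemma latE v x : L v x <-> intmx (x *m invmx (B v)).
Proof.
split=> [[c _ <-]|[c cE]]; first by exists c; rewrite -mulmxA mulmxV ?mulmx1.
by exists c => //; rewrite -cE mulmxKV.
Qed.

Lemma incE k u v : inc k u v <-> intmx (piK ^ k *: T u v).
Proof.
split=> [h|[M ME] x /latE[c cE]].
  apply/intmxP => i j.
  have /latE/intmxP/(_ 0 j) : L v (piK ^ k *: row i (B u)).
    apply: h; exists (delta_mx 0 i) => //; rewrite map_delta_mx.
    by rewrite [RHS]rowE.
  by rewrite -scalemxAl -row_mul !mxE.
apply/latE; exists (c *m M); rewrite map_mxM -cE -ME -scalemxAl -scalemxAr.
by rewrite mulmxA mulmxKV.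
Qed.

Lemma T_neq0 u v : T u v != 0.
Proof.
apply: contraTneq d_gt0 => T0; rewrite -leqNgt.
have := mxrank_unit (B_unit u); rewrite -[B u](mulmxKV (B_unit v)) T0 mul0mx.
by rewrite mxrank0 => <-.
Qed.

Lemma TT u w v : T u w *m T w v = T u v.
Proof. by rewrite mulmxA mulmxKV. Qed.

Lemma Tuu u : T u u = 1%:M.
Proof. exact: mulmxV. Qed.

Lemma inc_exists u v : exists n : nat, inc n u v.
Proof.
have [N NP] := choice (fun ij : 'I_d * 'I_d => integral_bound (T u v ij.1 ij.2)).
exists (\sum_ij N ij)%N; apply/incE/intmxP => i j; rewrite mxE.
apply: integral_piD (NP (i, j)) _; rewrite lez_nat.
by rewrite (bigD1 (i, j)) //= leq_addr.
Qed.

Lemma inc_lower u v : exists k : int, forall l, inc l u v -> k <= l.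
Proof.
have [i [j nz]] : exists i j, T u v i j != 0.
  apply: contrapT => h; case/eqP: (T_neq0 u v); apply/matrixP => i j.
  by rewrite [RHS]mxE; apply: contrapT => /eqP nz; apply: h; exists i, j.
have [k kP] := integral_lower nz; exists k => l /incE/intmxP/(_ i j).
by rewrite mxE => /kP.
Qed.

Lemma inc_le k l u v : inc k u v -> k <= l -> inc l u v.
Proof. by move=> /incE h kl; apply/incE; apply: intmx_piD kl. Qed.

Lemma inc_ge0 k u : 0 <= k -> inc k u u.
Proof.
move=> k0; have inc0 : inc 0 u u by move=> x; rewrite expr0z scale1r.
exact: inc_le inc0 k0.
Qed.

(** The admissible exponents are nonempty and bounded below, so the default value 0 in [nmin] is
    never what defines it. *)
Lemma nminP u v : inc (n_ u v) u v /\ forall m, inc m u v -> n_ u v <= m.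
Proof.
rewrite /nmin; set S := [set n | _].
suff ne : exists n, S n by apply: (xgetPex _ ne).
have [N NP] := inc_exists u v; have [k kP] := inc_lower u v.
pose P (m : nat) := `[< inc (k + m%:Z) u v >].
have exP : exists m, P m.
  exists `|N%:Z - k|%N; apply/asboolP.
  by rewrite gez0_abs ?subr_ge0 ?kP // addrCA subrr addr0.
case: (ex_minnP exP) => m /asboolP Pm minm.
exists (k + m%:Z); split=> // l il; have kl := kP _ il.
rewrite -[l](addrNK k) addrC lerD2r -[l - k]gez0_abs ?subr_ge0 // lez_nat.
by apply: minm; apply/asboolP; rewrite gez0_abs ?subr_ge0 // addrCA subrr addr0.
Qed.

Lemma nmin_inc u v : inc (n_ u v) u v.
Proof. by case: (nminP u v). Qed.
Arguments nmin_inc : clear implicits.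

Lemma nmin_le m u v : inc m u v -> n_ u v <= m.
Proof. by case: (nminP u v) => _; apply. Qed.

Lemma inc_comp k l u w v : inc l u w -> inc k w v -> inc (l + k) u v.
Proof.
move=> h1 h2 x xu; rewrite addrC expfzDr ?piK_neq0 // -scalerA.
exact/h2/h1.
Qed.

Lemma nmin_triangle u w v : n_ u v <= n_ u w + n_ w v.
Proof. exact/nmin_le/inc_comp/nmin_inc/nmin_inc. Qed.

Lemma nmin_id u : n_ u u = 0.
Proof.
apply/eqP; rewrite eq_le nmin_le /=; last by move=> x; rewrite expr0z scale1r.
pose k := Ordinal d_gt0; have /incE/intmxP/(_ k k) := nmin_inc u u.
by rewrite Tuu !mxE eqxx mulr1 => /integral_pi.
Qed.

Lemma mulpiE k u v M : piK ^ k *: T u v = map_mx tf M ->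
  mulpi pi res B k u v = linfun (mulmxr (map_mx res M)).
Proof. by move=> ME; rewrite /mulpi ME map_redK. Qed.

Local Opaque mulpi.

Lemma mulpi_comp k l u w v : inc l u w -> inc k w v ->
  (mulpi pi res B k w v \o mulpi pi res B l u w)%VF = mulpi pi res B (l + k) u v.
Proof.
move=> /incE[M ME] /incE[M' M'E].
have MM'E : piK ^ (l + k) *: T u v = map_mx tf (M *m M').
  rewrite map_mxM -ME -M'E -scalemxAl -scalemxAr scalerA TT.
  by rewrite expfzDr ?piK_neq0.
rewrite (mulpiE M'E) (mulpiE ME) (mulpiE MM'E).
by apply/lfunP => x; rewrite comp_lfunE !lfunE /= map_mxM mulmxA.
Qed.

Lemma mulpi_gt (k : int) u v : n_ u v < k -> mulpi pi res B k u v = 0.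
Proof.
move=> nk; have /incE[M ME] := nmin_inc u v.
pose m := absz (k - n_ u v - 1)%R.
have kE : k = n_ u v + m.+1%:Z.
  rewrite /m -addn1 PoszD gez0_abs; first by rewrite subrK addrCA subrr addr0.
  by rewrite subr_ge0 -gtz0_ge1 subr_gt0.
have kM : piK ^ k *: T u v = map_mx tf (pi ^+ m.+1 *: M).
  by rewrite kE addrC expfzDr ?piK_neq0 // -scalerA ME map_mxZ rmorphXn.
rewrite (mulpiE kM); apply/lfunP => x; rewrite zero_lfunE lfunE /= map_mxZ.
by rewrite rmorphXn /= res_pi expr0n scale0r mulmx0.
Qed.

(** If the reduced matrix vanished, a factor [pi] could be divided out and the exponent lowered by
    one. *)
Lemma fbar_neq0 u v : fb u v != 0.
Proof.
apply/eqP => f0; have /incE[M ME] := nmin_inc u v.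
have M0 : map_mx res M = 0.
  apply/row_matrixP => i; rewrite row0 rowE.
  have /(congr1 (fun g : 'End(_) => g (delta_mx 0 i))) := mulpiE ME.
  by rewrite -/(fbar pi res B u v) f0 zero_lfunE lfunE.
have [M' M'E] := map_res_eq0 M0.
have : n_ u v <= n_ u v - 1.
  apply/nmin_le/incE; exists M'.
  apply: (@scalerI _ _ piK); first exact: piK_neq0.
  rewrite scalerA -{1}[piK]expr1z -expfzDr ?piK_neq0 // addrC subrK ME M'E.
  by rewrite map_mxZ.
by rewrite leNgt ltrBlDr ltrDl ltr01.
Qed.

Lemma fbar_comp u w v :
  (fb w v \o fb u w)%VF = if n_ u v == n_ u w + n_ w v then fb u v else 0.
Proof.
rewrite /fbar mulpi_comp; [|exact: nmin_inc|exact: nmin_inc].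
case: eqP => [<-//|/eqP ne]; apply: mulpi_gt.
by rewrite lt_neqAle ne nmin_triangle.
Qed.

Lemma fbar_id u : fb u u = \1%VF.
Proof.
have E : piK ^ n_ u u *: T u u = map_mx tf 1%:M.
  by rewrite nmin_id expr0z scale1r Tuu map_mx1.
rewrite /fbar (mulpiE E); apply/lfunP => x.
by rewrite lfunE id_lfunE /= map_mx1 mulmx1.
Qed.

Lemma geo_fbar u w v : geo fb u w v = (n_ u v == n_ u w + n_ w v).
Proof.
rewrite /geo fbar_comp; case: ifP => _; first exact: eqxx.
by apply/negbTE; exact: fbar_neq0.
Qed.

Lemma fbar_map_res u v (c : 'rV[R]_d) :
  exists b, fb u v (map_mx res c) = map_mx res b /\
    map_mx tf b = piK ^ n_ u v *: (map_mx tf c *m T u v).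
Proof.
have /incE[M ME] := nmin_inc u v; exists (c *m M); split.
  by rewrite /fbar (mulpiE ME) lfunE /= map_mxM.
by rewrite map_mxM -ME -scalemxAr.
Qed.

Lemma fbar_ker u v c : fb u v (map_mx res c) = 0 ->
  L v (piK ^ (n_ u v - 1) *: (map_mx tf c *m B u)).
Proof.
have [b [-> bE]] := fbar_map_res u v c => /map_res_eq0[b' b'E].
apply/latE; exists b'; apply: (@scalerI _ _ piK); first exact: piK_neq0.
rewrite -map_mxZ -b'E bE -scalemxAl scalerA -mulmxA.
by congr (_ *: _); rewrite -{1}[piK]expr1z -expfzDr ?piK_neq0 // addrC subrK.
Qed.

Lemma fbar_img u v c b : map_mx tf c *m B u = piK ^ n_ v u *: (map_mx tf b *m B v) ->
  map_mx res c = fb v u (map_mx res b).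
Proof.
have [b' [-> b'E]] := fbar_map_res v u b => cE; congr (map_mx res _).
apply: map_tf_inj; rewrite b'E mulmxA scalemxAl -cE mulmxK //.
Qed.

(** A lift of a killed vector is carried into [L v] already by the exponent [n_ u v - 1], which here
    is [- n_ v u]; so the lift is [pi] to the power [n_ v u] times a vector of [L v]. *)
Lemma lker_limg u v : n_ u v + n_ v u = 1 -> lker (fb u v) = limg (fb v u).
Proof.
move=> n1; apply/eqP; rewrite eqEsubv; apply/andP; split; apply/subvP => x.
  have [c ->] := res_lift x; rewrite memv_ker => /eqP/fbar_ker.
  have -> : n_ u v - 1 = - n_ v u by rewrite -n1 opprD addrA subrr sub0r.
  case=> b _ bE; rewrite (@fbar_img u v c b) ?memv_img ?memvf //.
  by rewrite bE scalerA -expfzDr ?piK_neq0 // subrr expr0z scale1r.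
case/memv_imgP => y _ ->; rewrite memv_ker -comp_lfunE fbar_comp nmin_id.
by rewrite addrC n1 zero_lfunE.
Qed.

Hypothesis B_distinct : distinct_classes B.
Hypothesis B_convex : convex_config B.

Lemma nmin_loop u v : n_ u v + n_ v u = 0 -> u = v.
Proof.
move=> n0; apply: B_distinct; exists (piK ^ n_ u v).
  by rewrite expfz_neq0 ?piK_neq0.
apply/seteqP; split=> x; last by case=> y yu <-; apply: nmin_inc.
move=> xv; exists (piK ^ n_ v u *: x); first exact: nmin_inc.
by rewrite scalerA -expfzDr ?piK_neq0 // n0 expr0z scale1r.
Qed.

Lemma nmin_pos u v : u != v -> 1 <= n_ u v + n_ v u.
Proof.
move=> uv; rewrite -gtz0_ge1 lt_neqAle -(nmin_id u) nmin_triangle andbT nmin_id.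
by apply: contraNneq uv => /esym/nmin_loop ->.
Qed.

Lemma fbar_adj s z : z != s -> n_ s z + n_ z s = 1 -> adj fb s z.
Proof.
move=> zs n1; have n1' : n_ z s + n_ s z = 1 by rewrite addrC.
split; [exact: zs | exact: lker_limg | exact: lker_limg |].
move=> w ws; rewrite !geo_fbar => /eqP zE; rewrite eq_le nmin_triangle /=.
rewrite -(lerD2r (n_ w s)) -addrA -zE n1; apply: nmin_pos.
by rewrite eq_sym.
Qed.

Lemma intersection_class u v j : exists z k, forall x,
  (L u x /\ L v (piK ^ j *: x)) <-> L z (piK ^ (- k) *: x).
Proof.
have nz k : piK ^ k != 0 by rewrite expfz_neq0 ?piK_neq0.
have h1 : homothetic (L u) (L u).
  by exists 1; rewrite ?oner_neq0 //; apply/seteqP; split=> x;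
    [exists x; rewrite ?scale1r | case=> y yu <-; rewrite scale1r].
have h2 : homothetic (L v) [set x | L v (piK ^ j *: x)].
  exists (piK ^ (- j)); first exact: nz.
  apply/seteqP; split=> x.
    move=> xv; exists (piK ^ j *: x) => //.
    by rewrite scalerA -expfzDr ?piK_neq0 // addNr expr0z scale1r.
  case=> y yv <- /=.
  by rewrite scalerA -expfzDr ?piK_neq0 // subrr expr0z scale1r.
have [z [c nzc cE]] := B_convex h1 h2.
(* The homothety factor is a power of [pi] times a unit, and the unit does not change the
   lattice. *)
have [k [e [ue ceq]]] := field_decomp nzc.
have nze : tf e != 0 by rewrite tf_neq0; apply: contraTneq ue => ->; rewrite unitr0.
have Le a x : L z x -> L z (tf a *: x).
  by case=> b _ <-; exists (a *: b) => //; rewrite map_mxZ scalemxAl.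
exists z, k => x.
rewrite -[L u x /\ _]/((L u `&` [set x | L v (piK ^ j *: x)]) x) cE; split.
  case=> y yz <-; rewrite ceq scalerA mulrA -expfzDr ?piK_neq0 // addNr expr0z.
  by rewrite mul1r; apply: Le.
move=> xz; exists (tf e^-1 *: (piK ^ (- k) *: x)); first exact: Le.
rewrite ceq !scalerA rmorphV // (mulfK nze) -expfzDr ?piK_neq0 // subrr.
by rewrite expr0z scale1r.
Qed.

Lemma fbar_adj_exists u v : u != v -> exists z,
  [/\ adj fb u z, geo fb u z v, geo fb v z u & lker (fb u v) = limg (fb z u)].
Proof.
(* The exponent is one below minimal: [f u v] kills exactly the classes of those [x] in [L u] whose
   multiple by this power of [pi] lies in [L v]. *)
move=> uv; have [z [k zP]] := intersection_class u v (n_ u v - 1).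
have piD a b (x : 'rV[K]_d) : piK ^ a *: (piK ^ b *: x) = piK ^ (a + b) *: x.
  by rewrite scalerA -expfzDr ?piK_neq0.
have i_zu : inc k z u.
  move=> x xz; apply: (proj1 ((zP _).2 _)).
  by rewrite piD addNr expr0z scale1r.
have i_zv : inc (n_ u v - 1 + k) z v.
  move=> x xz; rewrite -piD; apply: (proj2 ((zP _).2 _)).
  by rewrite piD addNr expr0z scale1r.
have i_uz : inc (1 - k) u z.
  move=> x xu; rewrite addrC -piD; apply/zP; split.
    exact: (inc_ge0 _ (u := u)).
  by rewrite piD subrK; apply: nmin_inc.
have i_vz : inc (n_ v u - k) v z.
  move=> x xv; rewrite addrC -piD; apply/zP; split; first exact: nmin_inc.
  rewrite piD; apply: inc_ge0 xv.
  by rewrite addrAC subr_ge0 nmin_pos.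
have [e1 e2 e3 e4] := segment_lengths (nmin_le i_zu) (nmin_le i_vz)
  (nmin_le i_uz) (nmin_le i_zv) (nmin_triangle v z u) (nmin_triangle u z v).
have n1 : n_ u z + n_ z u = 1 by rewrite e1 e3 subrK.
have zu : z != u.
  by apply/eqP => zu; move: n1; rewrite zu nmin_id addr0 => /eqP; rewrite eq_sym oner_eq0.
exists z; split.
- exact: fbar_adj.
- rewrite geo_fbar e3 e4; apply/eqP; move: (n_ u v) => n; lia.
- by rewrite geo_fbar e1 e2 subrK.
apply/eqP; rewrite eqEsubv; apply/andP; split; apply/subvP => x.
  have [c ->] := res_lift x; rewrite memv_ker => /eqP/fbar_ker cv.
  have /zP[b _ bE] : L u (map_mx tf c *m B u) /\
      L v (piK ^ (n_ u v - 1) *: (map_mx tf c *m B u)) by split=> //; exists c.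
  rewrite (@fbar_img u z c b) ?memv_img ?memvf //.
  by rewrite bE piD e1 subrr expr0z scale1r.
case/memv_imgP => y _ ->; rewrite memv_ker -comp_lfunE fbar_comp e1 e4.
have -> : (n_ u v - 1 + k == k + n_ u v) = false.
  by apply/negP => /eqP; move: (n_ u v) => n; lia.
by rewrite zero_lfunE.
Qed.

Hypothesis B_lwi : forall v, locally_weakly_independent_at pi res B v.

Lemma lattice_lwi : exists I, lwi_maps fb I.
Proof.
have [I IP] := choice B_lwi; exists I; split.
- exact: fbar_id.
- exact: fbar_neq0.
- by move=> u w v; rewrite geo_fbar fbar_comp => /negPf->.
- by move=> u w; rewrite geo_fbar nmin_id eq_sym => /eqP/nmin_loop.
- exact: fbar_adj_exists.
- by move=> v; case: (IP v).
- by move=> u v uv; case: (IP v) => _ /(_ u uv)[w wI fw] _ _; exists w => //; apply/eqP.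
- by move=> v; case: (IP v).
Qed.

End Configuration.
End Lattices.

(** * Quiver representations *)

Section Paths.
Variables (F : fieldType) (V : eqType) (E : rel V).

Fixpoint qcat u w v (p : qpath E u w) : qpath E w v -> qpath E u v :=
  match p in qpath _ u w return qpath E w v -> qpath E u v with
  | QNil _ => id
  | QCons _ _ _ e q => fun p' => QCons e (qcat q p')
  end.

Lemma qcomp_cat (N : qrep F E) u w v (p : qpath E u w) (q : qpath E w v) x :
  qcomp N (qcat p q) x = qcomp N q (qcomp N p x).
Proof. by elim: p q x => //= ? ? ? e p IH q x; rewrite IH. Qed.

Lemma qcomp0 (N : qrep F E) u v (p : qpath E u v) : qcomp N p 0 = 0.
Proof. by elim: p => //= ? ? ? e p IH; rewrite linear0. Qed.

Lemma qhom_comp (N N' : qrep F E) (g : qhom N N') u v (p : qpath E u v) x :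
  g v (qcomp N p x) = qcomp N' p (g u x).
Proof. by elim: p x => //= ? ? ? e p IH x; rewrite IH qhomP. Qed.

Lemma qlength0 u v (p : qpath E u v) : qlength p = 0%N ->
  exists e : u = v, forall (N : qrep F E) x,
    qcomp N p x = eq_rect u (fun w => N w : Type) x v e.
Proof. by case: p => // w _; exists erefl. Qed.

End Paths.

(* Versions of [Mrep], [QGamma] and [subrep] for an arbitrary family of maps,
   to which those of a lattice configuration are convertible. *)
Section Representations.
Variables (F : fieldType) (V : finType) (d r : nat).
Variables (f : V -> V -> 'End('rV[F]_d)) (I : V -> {set V}).
Hypothesis Hf : lwi_maps f I.

Local Notation geo := (geo f).

Definition maps_rep (E : rel V) : qrep F E :=
  @QRep F V E (fun _ => 'rV[F]_d) (fun u v _ => f u v).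

Definition reduced_quiver : rel V := fun u v =>
  (u != v) &&
  ~~ `[< exists p : qpath (@Qfull V) u v,
         (2 <= qlength p)%N /\ qcomp (maps_rep (@Qfull V)) p =1 f u v >].

Definition sub_rep (U : grprod F V d r) : qrep F reduced_quiver :=
  @QRep F V reduced_quiver (fun v => subvs_of (gsub U v))
    (fun u v _ => vsproj (gsub U v) \o f u v \o vsval).

Local Notation Q := reduced_quiver.
Local Notation M E := (maps_rep E).

Lemma qcomp_fbar (E : rel V) u v (p : qpath E u v) :
  qcomp (M E) p =1 f u v \/ forall x, qcomp (M E) p x = 0.
Proof.
elim: p => [w|a c b e p [IH|IH]] /=.
- by left=> x; rewrite (fid Hf).
- have [h|h] := boolP (geo a c b); first by left=> x; rewrite IH geoE.
  by right=> x; rewrite IH (ngeoE Hf).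
by right=> x; rewrite IH.
Qed.

(** By [lwi_loop], no loop through a second vertex is geodesic. *)
Lemma qcomp_closed (E : rel V) u v (p : qpath E u v) :
  (forall a b, E a b -> a != b) -> (0 < qlength p)%N -> u = v ->
  forall x, qcomp (M E) p x = 0.
Proof.
move=> irr; case: p => // a c b e p _ ab x /=; subst b.
have nac : ~~ geo a c a by apply: contra (irr _ _ e) => /(lwi_loop Hf)->.
by case: (qcomp_fbar p) => h; rewrite h // (ngeoE Hf).
Qed.

Lemma reduced_neq u v : Q u v -> u != v.
Proof. by case/andP. Qed.

Lemma before_lt_from u w v : geo u w v -> w != u -> (before f w v < before f u v)%N.
Proof.
move=> uwv wu; apply/proper_card/fintype.properP; split.
  by apply/fintype.subsetP => a; rewrite !inE => /(geo_suffix Hf uwv)[].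
exists u; rewrite !inE ?(geo_sl Hf) //; apply: contra wu => h.
by rewrite (geo_antil Hf h uwv).
Qed.

(** A removed arrow has an interior geodesic vertex, and [before] is smaller for both pieces. *)
Lemma reduced_path u v : exists p : qpath Q u v, qcomp (M Q) p =1 f u v.
Proof.
move: {2}(before f u v).+1 (ltnSn (before f u v)) => n.
elim: n u v => // n IHn u v; rewrite ltnS => len.
have [<-|uv] := eqVneq u v.
  by exists (QNil Q u) => x /=; rewrite (fid Hf).
have [Quv|] := boolP (Q u v); first by exists (QCons Quv (QNil Q v)).
rewrite /reduced_quiver uv /= negbK => /asboolP[p [lp pE]].
(* [w] is the second vertex of a path making the arrow redundant. It is not [v], since the rest of
   the path would be a nontrivial loop with zero composite. *)
have [w [wu wv uwv]] : exists w, [/\ w != u, w != v & geo u w v].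
  case: p lp pE len uv => // a c b e q lq qE _ ab; exists c.
  have [x nzx] := f_nonzero Hf a b.
  have nq : ~ forall y, qcomp (M (@Qfull V)) q y = 0.
    by move=> q0; move/eqP: nzx; rewrite -qE /= q0.
  split; first by rewrite eq_sym; exact: e.
    by apply/eqP => cb; apply: nq; apply: qcomp_closed cb.
  case: (qcomp_fbar q) => // qf; apply: (geo_intro Hf (x := x)).
  by have := qE x; rewrite /= qf => ->.
have [p1 p1E] := IHn u w (leq_trans (before_lt Hf uwv wv) len).
have [p2 p2E] := IHn w v (leq_trans (before_lt_from uwv wu) len).
by exists (qcat p1 p2) => x; rewrite qcomp_cat p2E p1E geoE.
Qed.

Lemma arrows_stable (U : V -> {vspace 'rV[F]_d}) :
  (forall u v, Q u v -> (f u v @: U u <= U v)%VS) ->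
  forall u v, (f u v @: U u <= U v)%VS.
Proof.
move=> QU u v; have [p pE] := reduced_path u v.
suff H a b (q : qpath Q a b) x : x \in U a -> qcomp (M Q) q x \in U b.
  by apply/subvP => _ /memv_imgP[x xU ->]; rewrite -pE; apply: H.
elim: q x => //= a' c b' e q IH x xU; apply: IH.
by apply: (subvP (QU _ _ e)); apply: memv_img.
Qed.

Section OneSubrep.
Variable U : grprod F V d r.
Hypothesis HU : forall u v, (f u v @: gsub U u <= gsub U v)%VS.

Lemma val_qmap u v (e : Q u v) x : vsval (qmap (sub_rep U) e x) = f u v (vsval x).
Proof. by rewrite /= vsprojK // (subvP (HU u v)) // memv_img ?subvsP. Qed.

Lemma val_qcomp u v (p : qpath Q u v) (x : sub_rep U u) :
  vsval (qcomp (sub_rep U) p x) = qcomp (M Q) p (vsval x).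
Proof. by elim: p x => //= a c b e p IH x; rewrite IH val_qmap. Qed.

Lemma subrep_relations : satisfies_relations_of (M Q) (sub_rep U).
Proof.
split=> [u v p p0 x|u v p q pq x]; apply: val_inj => /=.
  by rewrite val_qcomp p0.
by rewrite !val_qcomp pq.
Qed.

End OneSubrep.

Section Projective.
Variable U : grprod F V d r.
Hypothesis HU : forall u v, (f u v @: gsub U u <= gsub U v)%VS.

(* [P_s] has a line at every vertex; it maps onto the simple representation
   [S_s] supported at [s]. *)
Definition free_rep (s : V) : qrep F Q :=
  @QRep F V Q (fun _ => 'rV[F]_1)
    (fun u v _ => mulmxr ((geo s u v)%:R%:M : 'M[F]_1)).

Definition simple_rep (s : V) : qrep F Q :=
  @QRep F V Q (fun u => 'rV[F]_(u == s)) (fun u v _ => mulmxr 0).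

Lemma simple_col (s u : V) (x y : 'rV[F]_(u == s)) : u != s -> x = y.
Proof. by case: (u == s) x y => // x y _; apply/rowP => -[]. Qed.

Lemma const_mx1K (b : bool) (y : 'rV[F]_b) :
  y *m (const_mx 1 : 'M_(b, 1)) *m (const_mx 1 : 'M_(1, b)) = y.
Proof.
case: b y => y; last by apply/rowP => -[].
rewrite -mulmxA -[RHS]mulmx1; congr (_ *m _); apply/matrixP => i j.
by rewrite !mxE !ord1 big_ord1 !mxE mulr1.
Qed.

(** A path acts on the free representation as 1 or 0 according to its effect on the vectors
    [f s u y]; this transfers the relations of [M Q]. *)
Lemma free_rep_comp s u v (p : qpath Q u v) :
  ((forall x, qcomp (free_rep s) p x = x) /\
   forall y, qcomp (M Q) p (f s u y) = f s v y) \/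
  ((forall x, qcomp (free_rep s) p x = 0) /\
   forall y, qcomp (M Q) p (f s u y) = 0).
Proof.
elim: p => [w|a c b e p IH] /=; first by left.
have [h|h] := boolP (geo s a c).
  case: IH => -[IH1 IH2]; [left | right]; split=> [x|y].
  - by rewrite IH1 mulmx1.
  - by rewrite (geoE _ h) IH2.
  - by rewrite IH1.
  by rewrite (geoE _ h) IH2.
right; split=> [x|y].
  by rewrite raddf0 mulmx0 (qcomp0 (free_rep s)).
by rewrite (ngeoE Hf _ h) (qcomp0 (M Q)).
Qed.

Lemma free_rep_relations s : satisfies_relations_of (M Q) (free_rep s).
Proof.
split=> [u v p p0|u v p q pq] x.
  have [y nzy] := f_nonzero Hf s v.
  case: (free_rep_comp s p) => -[h1 h2]; last exact: h1.
  by move: nzy; rewrite -h2 p0 eqxx.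
have [y nzy] := f_nonzero Hf s v; have := pq (f s u y).
case: (free_rep_comp s p) => -[-> ->]; case: (free_rep_comp s q) => -[-> ->] // h.
  by move: nzy; rewrite h eqxx.
by move: nzy; rewrite -h eqxx.
Qed.

Lemma simple_rep_relations s : satisfies_relations_of (M Q) (simple_rep s).
Proof.
have long u v (p : qpath Q u v) x : (0 < qlength p)%N -> qcomp (simple_rep s) p x = 0.
  by case: p x => //= a c b e p x _; rewrite mulmx0 (qcomp0 (simple_rep s)).
have nilp u v (p : qpath Q u v) : (forall x, qcomp (M Q) p x = 0) -> (0 < qlength p)%N.
  move=> p0; case: p p0 => // w /= w0; have [y] := f_nonzero Hf w w.
  by rewrite (w0 (f w w y)) eqxx.
split=> [u v p p0 x|u v p q pq x]; first exact/long/nilp.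
have [p0|np] := posnP (qlength p); have [q0|nq] := posnP (qlength q).
- have [e pE] := qlength0 F p0; have [e' qE] := qlength0 F q0.
  by rewrite pE qE (eq_irrelevance e e').
- have [e _] := qlength0 F p0.
  have q0 := qcomp_closed reduced_neq nq e.
  have : (0 < qlength p)%N by apply: nilp => y; rewrite pq q0.
  by rewrite p0.
- have [e _] := qlength0 F q0.
  have p0 := qcomp_closed reduced_neq np e.
  have : (0 < qlength q)%N by apply: nilp => y; rewrite -pq p0.
  by rewrite q0.
by rewrite !long.
Qed.

Definition functional_row (W : {vspace 'rV[F]_d}) (phi : 'Hom('rV[F]_d, F^o)) n
    (y : subvs_of W) : 'rV[F]_n := const_mx (phi (vsval y)).

Lemma functional_row_linear W phi n : linear (@functional_row W phi n).
Proof. by move=> a x y; apply/rowP => i; rewrite !mxE !linearP. Qed.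

HB.instance Definition _ W phi n :=
  GRing.isLinear.Build F (subvs_of W) 'rV[F]_n *:%R (@functional_row W phi n)
    (@functional_row_linear W phi n).

(** A torsion vector [x] outside the radical is detected by a morphism to the simple representation
    at [s]. Lifted to the free representation, [x] would have a nonzero value there, although it
    dies at [v] and a path realizing [f s v] acts there as the identity. *)
Lemma projective_torsion_free :
  projective_mod (M Q) (sub_rep U) -> torsion_free f (gsub U).
Proof.
move=> [_ lift] s v sv; apply/subvP => x; rewrite memv_cap memv_ker => /andP[xU /eqP fx].
apply/negPn/negP => /functional_sep[phi [phix phi0]].
have zero_at a b (e : Q a b) (y : 'rV[F]_1) :
    (y *m ((geo s a b)%:R%:M : 'M_1)) *m (const_mx 1 : 'M_(1, b == s)) = 0.
  have [bs|/eqP bs] := pselect (b = s); last exact: simple_col.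
  have -> : geo s a b = false.
    rewrite bs; apply/negP => /(lwi_loop Hf) sa; have := reduced_neq e.
    by rewrite -sa bs eqxx.
  by rewrite raddf0 mulmx0 mul0mx.
have gP a b (e : Q a b) (y : free_rep s a) :
    mulmxr (const_mx 1 : 'M[F]_(1, b == s)) (qmap (free_rep s) e y) =
    qmap (simple_rep s) e (mulmxr (const_mx 1 : 'M[F]_(1, a == s)) y).
  by rewrite /= mulmx0 zero_at.
pose g := @QHom _ _ _ (free_rep s) (simple_rep s)
  (fun u => mulmxr (const_mx 1 : 'M[F]_(1, u == s))) gP.
have hP a b (e : Q a b) (y : sub_rep U a) :
    functional_row phi (b == s) (qmap (sub_rep U) e y) =
    qmap (simple_rep s) e (functional_row phi (a == s) y).
  rewrite [RHS]mulmx0; have [bs|/eqP bs] := pselect (b = s); last exact: simple_col.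
  apply/rowP => i; rewrite !mxE; apply: phi0.
  rewrite (val_qmap HU) bs; apply: mem_rad; last exact: subvsP.
  by rewrite -bs; exact: reduced_neq e.
pose h := @QHom _ _ _ (sub_rep U) (simple_rep s)
  (fun u => @functional_row (gsub U u) phi (u == s)) hP.
have [|||h' h'P] := lift _ _ g h.
- exact: free_rep_relations.
- exact: simple_rep_relations.
- by move=> u y; exists ((y : 'rV_(u == s)) *m const_mx 1); exact: const_mx1K.
pose x' : sub_rep U s := vsproj (gsub U s) x.
have x'E : vsval x' = x by rewrite vsprojK.
have [p pE] := reduced_path s v.
have : h' v (qcomp (sub_rep U) p x') = 0.
  have -> : qcomp (sub_rep U) p x' = 0; last by rewrite linear0.
  by apply: val_inj; rewrite /= (val_qcomp HU) pE x'E fx.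
rewrite qhom_comp; case: (free_rep_comp s p) => -[h1 h2]; last first.
  have [y nzy] := f_nonzero Hf s v; move: (h2 y).
  by rewrite (fid Hf) pE => fy; rewrite fy eqxx in nzy.
rewrite h1 => h'0; have := h'P s x'; rewrite h'0 linear0.
have i0 : 'I_(s == s) by rewrite eqxx; exact: ord0.
by move=> /rowP/(_ i0)/esym/eqP; rewrite !mxE x'E phix oner_eq0.
Qed.

End Projective.
End Representations.

Section LinearCombination.
Variables (F : fieldType) (d r : nat) (W : {vspace 'rV[F]_d}) (C : 'M[F]_(d, r)).
Variables (L : lmodType F) (n : 'I_r -> L).

Definition combination (y : subvs_of W) : L := \sum_j (vsval y *m C) 0 j *: n j.

Lemma combination_linear : linear combination.
Proof.
move=> a x y; rewrite /combination scaler_sumr -big_split /=; apply: eq_bigr => j _.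
by rewrite mulmxDl -scalemxAl !mxE scalerDl scalerA.
Qed.

HB.instance Definition _ :=
  GRing.isLinear.Build F (subvs_of W) L *:%R combination combination_linear.

End LinearCombination.

(** * Projectivity and isomorphism of presented subrepresentations *)

Section Strata.
Variables (F : fieldType) (V : finType) (d r : nat).
Variables (f : V -> V -> 'End('rV[F]_d)) (I : V -> {set V}).
Hypothesis Hf : lwi_maps f I.

Local Notation geo := (geo f).
Local Notation Q := (reduced_quiver f).
Local Notation M := (maps_rep f Q).
Local Notation stable U :=
  (forall u v, (f u v @: gsub U u <= gsub U v)%VS).

Section PresentedProjective.
Variables (U : grprod F V d r) (ver : 'I_r -> V) (X : 'M[F]_(r, d)).
Hypothesis HU : stable U.
Hypothesis UX : forall b, spanned_by (gsub U b) (genframe f ver X b).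

Local Notation A b := (genframe f ver X b).

Lemma pres_free b : row_free (A b).
Proof. exact: presentation_free (dim_gsub U) UX b. Qed.

Lemma pres_row b j : row j (A b) \in gsub U b.
Proof. by rewrite UX row_sub. Qed.

Lemma pres_coord b y : y \in gsub U b -> y *m pinvmx (A b) *m A b = y.
Proof. by rewrite UX => /mulmxKpV. Qed.

Lemma pres_coord_f a b y : y \in gsub U a ->
  f a b y *m pinvmx (A b) = y *m pinvmx (A a) *m diag_mx (\row_j (geo (ver j) a b)%:R).
Proof.
move=> ya; apply: (row_free_inj (pres_free b)) => /=.
rewrite pres_coord; last exact: mem_f ya.
rewrite -[RHS]mulmxA -(presentation_img Hf) mulmxA pres_coord //.
by rewrite mul_rV_lin1.
Qed.

Lemma mul_diag_row (c : 'rV[F]_r) (e : 'I_r -> F) j :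
  (c *m diag_mx (\row_j e j)) 0 j = c 0 j * e j.
Proof. by rewrite mul_mx_diag !mxE. Qed.

(** The values at the generators are lifted to [N] and carried along chosen paths. The relations
    satisfied by [N] make the result compatible with the arrows, including the vanishing on
    non-geodesic composites. *)
Lemma presented_projective : projective_mod M (sub_rep f U).
Proof.
split=> [|N N' g h relN relN' surj]; first exact: subrep_relations HU.
have ex u v := cid (reduced_path Hf u v).
pose pth u v : qpath Q u v := projT1 (ex u v).
have pthE u v : qcomp M (pth u v) =1 f u v by rewrite /pth; case: (ex u v).
have rowX j : row j X \in gsub U (ver j).
  by rewrite -(fid Hf (ver j) (row j X)) -(row_genframe f) pres_row.
pose y j : sub_rep f U (ver j) := vsproj (gsub U (ver j)) (row j X).
have yE j : vsval (y j) = row j X by rewrite vsprojK.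
have ex_n j := cid (surj (ver j) (h (ver j) (y j))).
pose n j : N (ver j) := projT1 (ex_n j).
have nE j : g (ver j) (n j) = h (ver j) (y j) by rewrite /n; case: (ex_n j).
pose nn b j : N b := qcomp N (pth (ver j) b) (n j).
have nnE a b (e : Q a b) j : qmap N e (nn a j) = if geo (ver j) a b then nn b j else 0.
  pose p := qcat (pth (ver j) a) (QCons e (QNil Q b)).
  have pE x : qcomp N p x = qmap N e (qcomp N (pth (ver j) a) x) by rewrite qcomp_cat.
  have pME x : qcomp M p x = f a b (f (ver j) a x) by rewrite qcomp_cat /= pthE.
  rewrite /nn -pE; case: ifPn => hgeo.
    by apply: (proj2 relN) => x; rewrite pME pthE geoE.
  by apply: (proj1 relN) => x; rewrite pME (ngeoE Hf).
pose hh b := @combination F d r (gsub U b) (pinvmx (A b)) (N b) (nn b).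
have hhP a b (e : Q a b) (x : sub_rep f U a) :
    hh b (qmap (sub_rep f U) e x) = qmap N e (hh a x).
  rewrite /hh /combination linear_sum; apply: eq_bigr => j _.
  rewrite (val_qmap HU) pres_coord_f ?subvsP // mul_diag_row linearZ /= nnE.
  by case: ifP; rewrite ?mulr1 // mulr0 scale0r scaler0.
exists (@QHom _ _ _ (sub_rep f U) N
  (fun b => @combination F d r (gsub U b) (pinvmx (A b)) (N b) (nn b)) hhP).
move=> b x /=; rewrite /combination linear_sum.
have xE : x = \sum_j (vsval x *m pinvmx (A b)) 0 j *:
    qcomp (sub_rep f U) (pth (ver j) b) (y j).
  apply: subvs_inj; rewrite /= -[LHS](pres_coord (subvsP x)) mulmx_sum_row.
  rewrite linear_sum; apply: eq_bigr => j _; rewrite linearZ /=; congr (_ *: _).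
  by rewrite (val_qcomp HU) pthE yE row_genframe.
rewrite [in RHS]xE linear_sum; apply: eq_bigr => j _; rewrite !linearZ /=.
by congr (_ *: _); rewrite /nn !qhom_comp nE.
Qed.

End PresentedProjective.

Section Isomorphism.
Variables (U1 U2 : grprod F V d r) (ver : 'I_r -> V) (X1 X2 : 'M[F]_(r, d)).
Hypotheses (HU1 : stable U1) (HU2 : stable U2).
Hypothesis UX1 : forall b, spanned_by (gsub U1 b) (genframe f ver X1 b).
Hypothesis UX2 : forall b, spanned_by (gsub U2 b) (genframe f ver X2 b).

Definition transport b : {linear subvs_of (gsub U1 b) -> subvs_of (gsub U2 b)} :=
  vsproj (gsub U2 b) \o
    mulmxr (pinvmx (genframe f ver X1 b) *m genframe f ver X2 b) \o vsval.

Lemma val_transport b x : vsval (transport b x) =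
  vsval x *m pinvmx (genframe f ver X1 b) *m genframe f ver X2 b.
Proof. by rewrite /= vsprojK mulmxA // UX2 submxMl. Qed.

Lemma transportP u v (e : Q u v) (x : sub_rep f U1 u) :
  transport v (qmap (sub_rep f U1) e x) = qmap (sub_rep f U2) e (transport u x).
Proof.
apply: subvs_inj; rewrite [LHS]val_transport (val_qmap HU1) (val_qmap HU2).
rewrite [in RHS]val_transport (pres_coord_f HU1 UX1) ?subvsP //.
by rewrite -[LHS]mulmxA -(presentation_img Hf) mulmxA mul_rV_lin1.
Qed.

End Isomorphism.

Lemma transportK U1 U2 ver X1 X2 b :
  (forall b, spanned_by (gsub U1 b) (genframe f ver X1 b)) ->
  (forall b, spanned_by (gsub U2 b) (genframe f ver X2 b)) ->
  cancel (@transport U1 U2 ver X1 X2 b) (@transport U2 U1 ver X2 X1 b).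
Proof.
move=> UX1 UX2 x; apply: subvs_inj => /=.
rewrite [LHS](val_transport _ UX1) (val_transport _ UX2) mulmxKp ?(pres_free UX2) //.
by rewrite (pres_coord UX1) ?subvsP.
Qed.

Lemma presented_iso (ver : 'I_r -> V) (U1 U2 : grprod F V d r) : stable U1 -> stable U2 ->
  presented f ver (gsub U1) -> presented f ver (gsub U2) ->
  qiso (sub_rep f U1) (sub_rep f U2).
Proof.
move=> HU1 HU2 [X1 UX1] [X2 UX2].
exists (@QHom _ _ _ (sub_rep f U1) (sub_rep f U2) _ (transportP HU1 HU2 UX1 UX2)).
by move=> b; exists (@transport U2 U1 ver X2 X1 b); apply: transportK.
Qed.

(** The generators of [U] are pulled back through [phi]; their images at [b] are independent because
    [phi b] sends them to the independent generators of [U]. *)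
Lemma iso_presented (ver : 'I_r -> V) (W U : grprod F V d r) : stable W -> stable U ->
  presented f ver (gsub U) -> qiso (sub_rep f W) (sub_rep f U) ->
  presented f ver (gsub W).
Proof.
move=> HW HU [X UX] [phi bij].
have rowX j : row j X \in gsub U (ver j).
  by rewrite -(fid Hf (ver j) (row j X)) -(row_genframe f) (pres_row UX).
pose x j : sub_rep f U (ver j) := vsproj (gsub U (ver j)) (row j X).
have xE j : vsval (x j) = row j X by rewrite vsprojK.
have ex_y j : exists y, phi (ver j) y = x j.
  by have [psi _ psiK] := bij (ver j); exists (psi (x j)).
have [y yE] : exists y : forall j, sub_rep f W (ver j), forall j, phi (ver j) (y j) = x j.
  by exists (fun j => projT1 (cid (ex_y j))) => j; case: (cid (ex_y j)).
pose Y : 'M[F]_(r, d) := \matrix_j vsval (y j).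
exists Y => b; have rowY j : row j (genframe f ver Y b) \in gsub W b.
  by rewrite row_genframe rowK; apply/(subvP (HW _ b))/memv_img/subvsP.
apply: spanned_by_full => //; rewrite dim_gsub.
suff fr : row_free (genframe f ver Y b) by rewrite eq_leq //; apply/esym/eqP.
rewrite -kermx_eq0; apply/eqP/row_matrixP => i; rewrite row0.
set c := row i _; have c0 : c *m genframe f ver Y b = 0.
  by rewrite -row_mul mulmx_ker row0.
clearbody c; apply: (row_free_inj (pres_free UX b)); rewrite /= mul0mx.
pose z j : sub_rep f W b := vsproj (gsub W b) (row j (genframe f ver Y b)).
have zE j : vsval (z j) = row j (genframe f ver Y b) by rewrite vsprojK.
have sum0 : \sum_j c 0 j *: z j = 0.
  apply: subvs_inj; rewrite /= linear_sum -[RHS]c0 mulmx_sum_row.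
  by apply: eq_bigr => j _; rewrite linearZ /= zE.
have phiz j : vsval (phi b (z j)) = row j (genframe f ver X b).
  have [p pE] := reduced_path Hf (ver j) b.
  have -> : z j = qcomp (sub_rep f W) p (y j).
    by apply: subvs_inj; rewrite (val_qcomp HW) pE zE row_genframe rowK.
  by rewrite qhom_comp yE (val_qcomp HU) pE xE row_genframe.
have /(congr1 vsval) := congr1 (phi b) sum0.
rewrite linear0 linear_sum /= linear_sum => <-.
rewrite mulmx_sum_row; apply: eq_bigr => j _.
by rewrite linearZ linearZ /= phiz.
Qed.

End Strata.

(** * The linked Grassmannian *)

Section Irreducible.
Variable T : topologicalType.
Implicit Types A C : set T.

Lemma irreducible_closure A : irreducible_set A -> irreducible_set (closure A).
Proof.
move=> [[x Ax] irr]; split; first by exists x; apply: subset_closure.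
move=> C D cC cD ACD.
have cl E : closed E -> A `<=` E -> closure A `<=` E.
  by move=> cE /closureS; rewrite -(closure_id E).1.
have [h|h] : A `<=` C \/ A `<=` D by apply: irr => // y /subset_closure/ACD.
  by left; apply: cl.
by right; apply: cl.
Qed.

Lemma open_forall (J : finType) (O : J -> set T) :
  (forall j, open (O j)) -> open [set x | forall j, O j x].
Proof.
move=> oO; pose C (s : seq J) := [set x | forall j, j \in s -> O j x].
have oC s : open (C s).
  elim: s => [|j s IHs].
    by rewrite (_ : C [::] = setT); [exact: openT | apply/seteqP].
  rewrite (_ : C (j :: s) = O j `&` C s); first exact: openI.
  apply/seteqP; split=> x.
    by move=> h; split=> [|k ks]; apply: h; rewrite inE ?eqxx ?ks ?orbT.
  by case=> Ox Cx k; rewrite inE => /predU1P[->|/Cx].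
rewrite (_ : mkset _ = C (enum J)) //; apply/seteqP; split=> x h j //.
by apply: h; rewrite mem_enum.
Qed.

Lemma irreducible_cover (J : eqType) (s : seq J) (C : J -> set T) A :
  irreducible_set A -> (forall j, closed (C j)) ->
  (forall x, A x -> exists2 j, j \in s & C j x) -> exists2 j, j \in s & A `<=` C j.
Proof.
move=> [[x Ax] irr] cC; elim: s => [|j s IHs] cov; first by have [] := cov x Ax.
have [Aj|nAj] := pselect (A `<=` C j); first by exists j; rewrite ?mem_head.
pose D := [set y | exists2 k, k \in s & C k y].
have cD : closed D.
  rewrite /D; elim: (s) => [|k s' IH].
    rewrite (_ : mkset _ = set0); first exact: closed0.
    by apply/seteqP; split=> // y [].
  rewrite (_ : mkset _ = C k `|` [set y | exists2 k, k \in s' & C k y]).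
    exact: closedU.
  apply/seteqP; split=> y.
    by case=> l; rewrite inE => /predU1P[->|ls] Cy; [left | right; exists l].
  by case=> [Cy|[l ls Cy]]; [exists k | exists l] => //; rewrite inE ?eqxx ?ls ?orbT.
have [|//|AD] := irr (C j) D (cC j) cD.
  move=> y /cov[k]; rewrite inE => /predU1P[->|ks] Cy; first by left.
  by right; exists k.
have [k ks Ak] := IHs AD.
by exists k => //; rewrite inE ks orbT.
Qed.

End Irreducible.

Section LinkedGrassmannian.
Variables (F : closedFieldType) (V : finType) (d r : nat).
Variables (f : V -> V -> 'End('rV[F]_d)) (I : V -> {set V}).
Hypothesis Hf : lwi_maps f I.
Variable v0 : V.
Variable Z : set (grprod F V d r).
Hypothesis ZP : forall U, Z U <-> forall u v, (f u v @: gsub U u <= gsub U v)%VS.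

Local Notation T := (set_type Z).
Local Notation sub W := (gsub (set_val W)).
Local Notation M := (maps_rep f (reduced_quiver f)).
Local Notation projective W := (projective_mod M (sub_rep f (set_val W))).
Local Notation rkv W a b := (\dim (f a b @: sub W a)).

Lemma stable_val (W : T) u v : (f u v @: sub W u <= sub W v)%VS.
Proof. by apply: (ZP _).1; apply: set_mem; exact: (valP W). Qed.

Lemma linked_val (W : T) : linked r f (sub W).
Proof. by split=> [v|u v]; [exact: dim_gsub | exact: stable_val]. Qed.

Lemma set_type_lift (U : grprod F V d r) :
  (forall u v, (f u v @: gsub U u <= gsub U v)%VS) -> exists W : T, set_val W = U.
Proof. by move=> /ZP/mem_set ZU; exists (exist _ U ZU). Qed.

Lemma projective_presented (W : T) :
  projective W <-> exists ver, presented (r := r) f ver (sub W).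
Proof.
split=> [/(projective_torsion_free Hf (stable_val W))|[ver [X WX]]].
  exact: (torsion_free_presented Hf v0 (linked_val W)).
exact: (presented_projective Hf (stable_val W) WX).
Qed.

(** Staying in [O], keeping full frame rank and not lowering any rank are nonvanishing conditions on
    polynomials in [t] that hold at 0. Together with [t != 0] they have a common solution over an
    algebraically closed field. *)
Lemma deform (U : T) (O : set T) : open O -> O U -> ~ torsion_free f (sub U) ->
  exists W : T, [/\ O W, forall a b, (rkv U a b <= rkv W a b)%N &
    exists a b, (rkv U a b < rkv W a b)%N].
Proof.
move=> openO OU ntf; have HU := stable_val U.
have [s [v [phi [u [defP rkP]]]]] := deformation Hf HU (dim_gsub (set_val U)) ntf.
have [A fA] := frame_exists (set_val U).
pose mv (t : F) b (y : 'rV[F]_d) : 'rV[F]_d := y + t * phi b y *: u b.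
pose At (t : F) b : 'M[F]_(r, d) := \matrix_i mv t b (row i (A b)).
have AtE t b (c : 'rV[F]_r) : c *m At t b = mv t b (c *m A b).
  have phiZ a y : phi b (a *: y) = a * phi b y by rewrite linearZ.
  rewrite !mulmx_sum_row /mv linear_sum /= mulr_sumr scaler_suml -big_split /=.
  apply: eq_bigr => i _; rewrite rowK /mv scalerDr phiZ scalerA.
  by congr (_ + _ *: _); rewrite mulrCA.
have At0 b : At 0 b = A b.
  by apply/row_matrixP => i; rewrite rowK /mv mul0r scale0r addr0.
have pAt b : polymx (fun t => At t b).
  move=> i j; apply: (@polyfun_ext _
    (fun t => A b i j + t * (phi b (row i (A b)) * u b 0 j))).
    by move=> t; rewrite !mxE mulrA.
  apply: polyfunD; first exact: polyfun_cst.
  by apply: polyfunM; [exact: polyfun_id | exact: polyfun_cst].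
have [P [nzP PO]] := open_plucker openO OU fA.
have At0E : At 0 = A by apply/funext.
have g1 : generic (fun t : F => t != 0) := generic_neq0 (polyfun_id F) (oner_neq0 F).
have g2 : generic (fun t => forall b, (\rank (At 0%R b) <= \rank (At t b))%N).
  by apply: generic_forall => b; apply: generic_rank.
have g3 : generic (fun t => mpoly.meval (plucker (At t)) P != 0).
  by apply: (@generic_neq0 _ _ 0); [exact: polyfun_plucker | rewrite At0E].
have g4 : generic (fun t => forall ab : V * V,
    (\rank (At 0%R ab.1 *m lin1_mx (f ab.1 ab.2)) <=
     \rank (At t ab.1 *m lin1_mx (f ab.1 ab.2)))%N).
  apply: generic_forall => ab.
  by apply: (@generic_rank _ _ _ (fun t => At t ab.1 *m _)); apply: polymx_mulr.
have [t [[t0 rkt] [nzt rkft]]] :=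
  generic_exists (generic_and (generic_and g1 g2) (generic_and g3 g4)).
have frt b : row_free (At t b).
  rewrite /row_free eqn_leq rank_leq_row /=; apply: leq_trans (rkt b).
  by rewrite At0 eq_leq //; apply/esym/eqP/(frame_free b fA).
have [W0 fW0] := frame_realize frt.
have mvW y b : y \in sub U b -> mv t b y \in gsub W0 b.
  by rewrite fA fW0 => /submxP[c ->]; rewrite -AtE submxMl.
have [|W WE] := set_type_lift (U := W0).
  move=> a b; apply/subvP => _ /memv_imgP[x xW ->].
  move: xW; rewrite fW0 => /submxP[c ->]; rewrite AtE.
  have cU : c *m A a \in sub U a by rewrite fA submxMl.
  by have [y' yU ->] := defP t a b _ cU; apply: mvW.
exists W; rewrite -WE in fW0 mvW; split.
- exact: PO fW0 nzt.
- move=> a b; rewrite (dim_spanned (spanned_img (f a b) (fA a))).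
  rewrite (dim_spanned (spanned_img (f a b) (fW0 a))) -At0.
  exact: (rkft (a, b)).
by exists s, v; apply: (rkP t _ t0) => y yU; apply: mvW.
Qed.

Lemma rk_bound (W : T) a b : (rkv W a b <= r)%N.
Proof.
have := limg_ker_dim (f a b) (sub W a); rewrite dim_gsub => dE.
by rewrite -[X in (_ <= X)%N]dE leq_addl.
Qed.

(** Deforming inside [O] lowers the total rank defect, so the process stops, necessarily at a
    torsion-free point. *)
Lemma dense_projective : dense [set W : T | projective W].
Proof.
move=> O [U OU] openO.
pose total (W : T) := (\sum_(ab : V * V) (r - rkv W ab.1 ab.2))%N.
move: {2}(total U).+1 (ltnSn (total U)) => n; elim: n U OU => // n IHn U OU len.
have [tf|ntf] := pselect (torsion_free f (sub U)).
  exists U; split=> //; apply/projective_presented.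
  exact: (torsion_free_presented Hf v0 (linked_val U) tf).
have [W [OW le [a [b lt]]]] := deform openO OU ntf.
apply: (IHn W OW); rewrite ltnS in len; apply: leq_trans len; rewrite /total.
rewrite (bigD1 (a, b)) //= [X in (_ < X)%N](bigD1 (a, b)) //= -addSn leq_add //.
  by apply: ltn_sub2l => //; exact: (leq_trans lt (rk_bound W a b)).
by apply: leq_sum => ab _; apply/leq_sub2l/le.
Qed.

Lemma presented_maximal ver (U W : T) : presented (r := r) f ver (sub U) ->
  (forall a b, (rkv U a b <= rkv W a b)%N) -> presented f ver (sub W).
Proof.
move=> pU le.
have [ver' [pW fib]] := presented_le Hf v0 (linked_val U) pU (linked_val W) le.
by apply: presented_perm pW.
Qed.

Lemma projective_maximal (U : T) : projective U <->
  forall W : T, (forall a b, (rkv U a b <= rkv W a b)%N) ->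
    (fun a b => rkv W a b) = (fun a b => rkv U a b).
Proof.
rewrite projective_presented; split=> [[ver pU] W le|Umax].
  have pW := presented_maximal pU le.
  apply/funext => a; apply/funext => b.
  rewrite -[LHS]/(rk f (sub W) a b) -[RHS]/(rk f (sub U) a b).
  by rewrite (presented_rk Hf _ _ (dim_gsub _) pW) (presented_rk Hf _ _ (dim_gsub _) pU).
have [tf|ntf] := pselect (torsion_free f (sub U)).
  exact: (torsion_free_presented Hf v0 (linked_val U) tf).
have [W [_ le [a [b]]]] := deform openT Logic.I ntf.
by rewrite -[rkv W a b]/((fun a b => rkv W a b) a b) (Umax W le) ltnn.
Qed.

Definition presented_locus (ver : 'I_r -> V) : set T :=
  [set W | presented f ver (sub W)].

Lemma open_presented_locus ver : open (presented_locus ver).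
Proof.
have [[U pU]|none] := pselect (exists U, presented_locus ver U); last first.
  rewrite (_ : presented_locus ver = set0); first exact: open0.
  by apply/seteqP; split=> // W pW; apply: none; exists W.
rewrite (_ : presented_locus ver =
    [set W : T | forall ab : V * V, (rkv U ab.1 ab.2 <= rkv W ab.1 ab.2)%N]).
  by apply: open_forall => ab; apply: open_rank.
apply/seteqP; split=> W; last first.
  by move=> h; apply: presented_maximal pU _ => a b; apply: (h (a, b)).
move=> pW [a b] /=; rewrite -/(rk f (sub U) a b) -/(rk f (sub W) a b).
by rewrite (presented_rk Hf _ _ (dim_gsub _) pW) (presented_rk Hf _ _ (dim_gsub _) pU).
Qed.

Lemma genframe_line ver (X Y : 'M[F]_(r, d)) t b :
  genframe f ver (X + t *: Y) b = genframe f ver X b + t *: genframe f ver Y b.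
Proof.
apply/row_matrixP => i; rewrite linearD linearZ /= !row_genframe.
by rewrite linearD linearZ /= linearD linearZ.
Qed.

(* Two points with the same arrangement of generators are joined by the line
   through their generators, which leaves the stratum only at finitely many
   parameters. *)
Lemma irreducible_presented_locus ver :
  presented_locus ver !=set0 -> irreducible_set (presented_locus ver).
Proof.
move=> ne; split=> // C D cC cD CD; apply: contrapT => /not_orP[].
move=> /existsNP[W1 /not_implyP[[X1 WX1] nC]] /existsNP[W2 /not_implyP[[X2 WX2] nD]].
have [P1 [nz1 PC]] := open_plucker (closed_openC cC) nC WX1.
have [P2 [nz2 PD]] := open_plucker (closed_openC cD) nD WX2.
pose A t b := genframe f ver (X1 + t *: (X2 - X1)) b.
have A0 : A 0 = genframe f ver X1 by apply/funext => b; rewrite /A scale0r addr0.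
have A1 : A 1 = genframe f ver X2.
  by apply/funext => b; rewrite /A scale1r addrC subrK.
have pA b : polymx (fun t => A t b).
  move=> i j; apply: (@polyfun_ext _ (fun t =>
    genframe f ver X1 b i j + t * genframe f ver (X2 - X1) b i j)).
    by move=> t; rewrite /A genframe_line !mxE.
  apply: polyfunD; first exact: polyfun_cst.
  by apply: polyfunM; [exact: polyfun_id | exact: polyfun_cst].
have g1 : generic (fun t => mpoly.meval (plucker (A t)) P1 != 0).
  by apply: (@generic_neq0 _ _ 0); [exact: polyfun_plucker | rewrite A0].
have g2 : generic (fun t => mpoly.meval (plucker (A t)) P2 != 0).
  by apply: (@generic_neq0 _ _ 1); [exact: polyfun_plucker | rewrite A1].
have g3 : generic (fun t => forall b, (\rank (A 0%R b) <= \rank (A t b))%N).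
  by apply: generic_forall => b; apply: generic_rank.
have [t [[nzt1 nzt2] rkt]] := generic_exists (generic_and (generic_and g1 g2) g3).
have frt b : row_free (A t b).
  rewrite /row_free eqn_leq rank_leq_row /=; apply: leq_trans (rkt b).
  by rewrite A0 eq_leq //; apply/esym/eqP/(frame_free b WX1).
have [W0 fW0] := frame_realize frt.
have [|W WE] := set_type_lift (U := W0).
  move=> a b; apply/subvP => _ /memv_imgP[x xW ->].
  move: xW; rewrite fW0 => /submxP[c ->]; rewrite mulmx_sum_row linear_sum.
  apply: memv_suml => j _; rewrite linearZ memvZ //= (f_row_genframe Hf).
  by case: ifP => _; rewrite ?mem0v // fW0 row_sub.
rewrite -WE in fW0.
have [] : (C `|` D) W by apply: CD; exists (X1 + t *: (X2 - X1)).
  exact: PC fW0 nzt1.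
exact: PD fW0 nzt2.
Qed.

(** Taking [ver] in a finite type makes the set of points outside all the closures open; if
    nonempty, it would contain a projective point. *)
Lemma closure_loci (W : T) : exists ver : {ffun 'I_r -> V},
  closure (presented_locus ver) W.
Proof.
pose C := [set W | forall ver : {ffun 'I_r -> V}, ~ closure (presented_locus ver) W].
apply: contrapT => nW; have oC : open C.
  apply: open_forall => ver; apply: closed_openC; exact: closed_closure.
have CW : C W by move=> ver cW; apply: nW; exists ver.
have [U [CU /projective_presented[ver pU]]] := dense_projective (ex_intro _ W CW) oC.
apply: (CU [ffun i => ver i]); apply: subset_closure.
suff -> : [ffun i => ver i] = ver :> ('I_r -> V) by [].
by apply/funext => i; rewrite ffunE.
Qed.

Lemma stratum_locus ver (U : T) : presented_locus ver U ->
  [set W : T | qiso (sub_rep f (set_val W)) (sub_rep f (set_val U))] =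
  presented_locus ver.
Proof.
move=> pU; apply/seteqP; split=> W.
  exact: (iso_presented Hf (stable_val W) (stable_val U) pU).
move=> pW; exact: (presented_iso Hf (stable_val W) (stable_val U) pW pU).
Qed.

Lemma components C : irreducible_component C <->
  exists2 U : T, projective U & C =
    closure [set W : T | qiso (sub_rep f (set_val W)) (sub_rep f (set_val U))].
Proof.
split=> [[irrC maxC]|[U /projective_presented[ver pU] ->]]; last first.
  rewrite (stratum_locus pU).
  have irr := irreducible_presented_locus (ex_intro _ U pU).
  split=> [|A irrA sub]; first exact: irreducible_closure.
  (* Openness of the locus splits the irreducible [A] into two closed sets, and the complement
     cannot contain [A], as [U] lies in [A]. *)
  have [||//|sA|sA] := irrA.2 (closure (presented_locus ver)) (~` presented_locus ver).
  - exact: closed_closure.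
  - exact/open_closedC/open_presented_locus.
  - move=> W _; have [pW|npW] := pselect (presented_locus ver W); last by right.
    by left; apply: subset_closure.
  - by apply/seteqP.
  by case: (sA U) => //; apply/sub/subset_closure.
have [||ver _ sC] := @irreducible_cover _ _ (enum {: {ffun 'I_r -> V}})
    (fun ver => closure (presented_locus ver)) C irrC.
- by move=> ver; apply: closed_closure.
- by move=> W _; have [ver cW] := closure_loci W; exists ver; rewrite ?mem_enum.
have [U pU] : presented_locus ver !=set0.
  have [[W CW] _] := irrC; apply: contrapT => ne.
  have e : presented_locus ver = set0.
    by apply/seteqP; split=> // U pU; apply: ne; exists U.
  by have := sC W CW; rewrite e closure0.
exists U; first by apply/projective_presented; exists ver.
rewrite (stratum_locus pU); apply/esym/maxC => //.
exact/irreducible_closure/irreducible_presented_locus/(ex_intro _ U pU).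
Qed.

End LinkedGrassmannian.

(** Exponents above the minimal one induce the zero map, so only the maps [fbar] impose
    conditions. *)
Lemma LG0_setP (R : idomainType) (pi : R) (F : fieldType)
    (res : {rmorphism R -> F}) (V : finType) (d r : nat)
    (B : V -> 'M[{fraction R}]_d) :
  is_dvr R -> is_uniformizer pi -> is_residue_map res -> (0 < d)%N ->
  (forall v, B v \in unitmx) -> forall U : grprod F V d r,
  LG0_set pi res B U <-> forall u v, (fbar pi res B u v @: gsub U u <= gsub U v)%VS.
Proof.
move=> dvr unif resP d0 Bu U; split=> [h u v|h u v k kuv].
  by apply: h; apply: (nmin_inc dvr unif d0 Bu).
have := nmin_le dvr unif d0 Bu kuv.
rewrite Order.POrderTheory.le_eqVlt => /orP[/eqP <-|lt].
  exact: h.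
rewrite (mulpi_gt dvr unif resP d0 Bu lt); apply/subvP => _ /memv_imgP[x _ ->].
by rewrite zero_lfunE mem0v.
Qed.

Theorem proposition4p21 (R : idomainType) (pi : R) (kappa : closedFieldType)
    (res : {rmorphism R -> kappa}) (V : finType) (d r : nat)
    (B : V -> 'M[{fraction R}]_d)
    (R_dvr : is_dvr R) (pi_unif : is_uniformizer pi)
    (res_residue : is_residue_map res)
    (r_gt0 : (0 < r)%N) (r_lt_d : (r < d)%N)
    (V_nonempty : (0 < #|V|)%N)
    (B_unit : forall v, B v \in unitmx)
    (B_distinct : distinct_classes B)
    (Gamma_lwi : locally_weakly_independent pi res B) :
  [/\ LG0_set pi res B (r := r) = quiver_grassmannian pi res B (r := r),
      dense [set M : LG0 pi res B r | projective_point M],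
      forall M : LG0 pi res B r,
        projective_point M <-> maximal_rank_vector M &
      forall C : set (LG0 pi res B r),
        irreducible_component C <->
        exists2 M : LG0 pi res B r,
          projective_point M & C = closure (stratum M)].
Proof.
have d_gt0 : (0 < d)%N := ltn_trans r_gt0 r_lt_d.
have [v0 _] := card_gt0P V_nonempty; case: Gamma_lwi => convex lwi.
have [I Hf] := lattice_lwi R_dvr pi_unif res_residue d_gt0 B_unit B_distinct convex lwi.
have ZP := @LG0_setP _ _ _ res V d r B R_dvr pi_unif res_residue d_gt0 B_unit.
split.
- apply/seteqP; split=> U; first by move=> /ZP h u v _; apply: h.
  by move=> h; apply/ZP; apply: (arrows_stable Hf); apply: h.
- exact: (dense_projective Hf v0 ZP).
- move=> M; split.
    move=> /(projective_maximal Hf v0 ZP) h W le; exact: (h W le).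
  move=> h; apply/(projective_maximal Hf v0 ZP) => W le; exact: (h W le).
- move=> C; exact: (components Hf v0 ZP C).
Qed.
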